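(* Let $\bm{a}$ and $\bm{b}$ be two measure preserving actions of a countable amenable group $\Gamma$. Then: (1) $\mathrm{type}(\bm{a})=\mathrm{type}(\bm{b})$ if and only if $\bm{a}\sim_s\bm{b}$. (2) Suppose that $\mathrm{type}(\bm{a})=\mathrm{type}(\bm{b})$ concentrates on the infinite index subgroups of $\Gamma$. Then $\bm{a}\sim\bm{b}$.
   Context: A measure preserving action $\bm{a}=\Gamma\curvearrowright^a(X,\mu)$ of a countable group $\Gamma$ is a Borel action $a$ of $\Gamma$ on a standard Borel space $X$ preserving a Borel probability measure $\mu$ on $X$. Weak containment: for $\bm{a}$ on $(X,\mu)$ and $\bm{b}$ on $(Y,\nu)$, $\bm{a}\prec\bm{b}$ means that for every finite Borel partition $A_0,\dots,A_{k-1}$ of $X$, every finite $F\subseteq\Gamma$, and every $\epsilon>0$ there is a Borel partition $B_0,\dots,B_{k-1}$ of $Y$ with $|\mu(\gamma^aA_i\cap A_j)-\nu(\gamma^bB_i\cap B_j)|<\epsilon$ for all $\gamma\in F$ and $i,j<k$. $\bm{a}\sim\bm{b}$ (weak equivalence) means $\bm{a}\prec\bm{b}$ and $\bm{b}\prec\bm{a}$. Stable weak containment: $\bm{a}\prec_s\bm{b}$ means that for every finite Borel partition $A_0,\dots,A_{k-1}$ of $X$, finite $F\subseteq\Gamma$ and $\epsilon>0$ there are $m\geq1$, reals $\alpha_0,\dots,\alpha_{m-1}\geq0$ with $\sum_{l<m}\alpha_l=1$, and a Borel partition $B_0,\dots,B_{k-1}$ of $\{0,\dots,m-1\}\times Y$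 such that $|\mu(\gamma^aA_i\cap A_j)-(\eta_\alpha\times\nu)(\gamma^{\iota\times b}B_i\cap B_j)|<\epsilon$ for all $i,j<k$ and $\gamma\in F$, where $\eta_\alpha(\{l\})=\alpha_l$ and $\gamma^{\iota\times b}(l,y)=(l,\gamma^by)$. $\bm{a}\sim_s\bm{b}$ (stable weak equivalence) means $\bm{a}\prec_s\bm{b}$ and $\bm{b}\prec_s\bm{a}$. (Equivalently, $\bm{a}\prec_s\bm{b}$ iff $\bm{a}\prec\bm{\iota}\times\bm{b}$, where $\bm{\iota}$ is the identity action on a standard non-atomic probability space.) $\mathrm{Sub}(\Gamma)\subseteq2^\Gamma$ is the compact space of subgroups of $\Gamma$. The type of $\bm{a}=\Gamma\curvearrowright^a(X,\mu)$ is the conjugation-invariant Borel probability measure $\mathrm{type}(\bm{a})=(\mathrm{stab}_a)_*\mu$ on $\mathrm{Sub}(\Gamma)$, where $\mathrm{stab}_a(x)=\{\gamma\in\Gamma:\gamma^ax=x\}$. *)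

(* Defs.v *)
From HB Require Import structures.
From mathcomp Require Import all_boot all_order all_algebra.
From mathcomp Require Import all_classical all_reals all_analysis.

Set Implicit Arguments.
Unset Strict Implicit.
Unset Printing Implicit Defensive.

Import Order.TTheory GRing.Theory Num.Theory.
Import numFieldNormedType.Exports.

Local Open Scope classical_set_scope.
Local Open Scope ring_scope.

HB.structure Definition CountGroup := {G of Group G & Countable G}.
Notation countGroupType := CountGroup.type.

(* A Gamma-invariant mean on the bounded real functions on Gamma; the values of
   m on unbounded functions are unconstrained. *)
Definition amenable (R : realType) (Gamma : countGroupType) : Prop :=
  let bnd (f : Gamma -> R) := exists M, forall g, `|f g| <= M in
  exists m : (Gamma -> R) -> R,
    [/\ forall (c : R) f1 f2, bnd f1 -> bnd f2 ->
          m (fun g => c * f1 g + f2 g) = c * m f1 + m f2,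
        forall f, bnd f -> (forall g, 0 <= f g) -> 0 <= m f,
        m (fun=> 1) = 1
      & forall h f, bnd f -> m (fun g => f (h * g)%g) = m f].

Definition borel {T : topologicalType} : set (set T) := <<s @open T >>.

Definition polish (R : realType) (P : metricType R) : Prop :=
  (exists2 D : set P, countable D & dense D) /\
  (forall u : nat -> P, cauchy (u @ \oo) -> exists l : P, u @ \oo --> l).

Definition standard_borel (R : realType) d (X : measurableType d) : Prop :=
  exists P : metricType R, polish P /\
  exists2 f : X -> P, bijective f & measurable = [set f @^-1` B | B in borel].

(* Gamma is discrete, so an action is Borel as soon as every element acts by a
   Borel map. *)
Record pmp_action (R : realType) (Gamma : countGroupType) := PMPAction {
  display : measure_display;
  space :> measurableType display;
  standard_space : standard_borel R space;
  meas : probability space R;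
  act : Gamma -> space -> space;
  act1 : forall x, act 1%g x = x;
  actM : forall g h x, act (g * h)%g x = act g (act h x);
  measurable_act : forall g, measurable_fun [set: space] (act g);
  meas_act : forall g A, measurable A -> meas (act g @^-1` A) = meas A
}.
Arguments meas {R Gamma} p.
Arguments act {R Gamma} p.

(* Unlike classical_sets.partition, pieces may be empty. *)
Definition borel_partition d (X : measurableType d) (k : nat)
    (A : 'I_k -> set X) : Prop :=
  [/\ forall i, measurable (A i), trivIset [set: 'I_k] A
    & \bigcup_i A i = [set: X]].

Definition close_correlations (R : realType) (Gamma : countGroupType)
    (X Y : Type) (mu : set X -> \bar R) (a : Gamma -> X -> X)
    (nu : set Y -> \bar R) (b : Gamma -> Y -> Y) (F : set Gamma) (eps : R)
    (k : nat) (A : 'I_k -> set X) (B : 'I_k -> set Y) : Prop :=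
  forall g, F g -> forall i j,
    (`| mu (a g @` A i `&` A j) - nu (b g @` B i `&` B j) | < eps%:E)%E.

Definition weakly_contained (R : realType) (Gamma : countGroupType)
    (a b : pmp_action R Gamma) : Prop :=
  forall (k : nat) (A : 'I_k -> set a) (F : set Gamma) (eps : R),
    borel_partition A -> finite_set F -> 0 < eps ->
    exists2 B : 'I_k -> set b, borel_partition B &
      close_correlations (meas a) (act a) (meas b) (act b) F eps A B.

Definition weakly_equivalent (R : realType) (Gamma : countGroupType)
    (a b : pmp_action R Gamma) : Prop :=
  weakly_contained a b /\ weakly_contained b a.

HB.instance Definition _ (m : nat) := isPointed.Build 'I_m.+1 ord0.

HB.instance Definition _ (m : nat) :=
  @isMeasurable.Build default_measure_display 'I_m.+1 discrete_measurable
    discrete_measurable0 discrete_measurableC discrete_measurableU.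

(* The sum of alpha_l delta_l over l <= m; msum is indexed by nat, hence the
   inord. *)
Definition eta (R : realType) (m : nat) (alpha : 'I_m.+1 -> {nonneg R}) :
    {measure set 'I_m.+1 -> \bar R} :=
  msum (fun l => mscale (alpha (inord l)) (dirac (inord l : 'I_m.+1))) m.+1.

(* The number of weights is m.+1, which ranges over all integers >= 1. *)
Definition stably_weakly_contained (R : realType) (Gamma : countGroupType)
    (a b : pmp_action R Gamma) : Prop :=
  forall (k : nat) (A : 'I_k -> set a) (F : set Gamma) (eps : R),
    borel_partition A -> finite_set F -> 0 < eps ->
    exists (m : nat) (alpha : 'I_m.+1 -> {nonneg R}),
      \sum_l (alpha l)%:num = 1 /\
      exists2 B : 'I_k -> set ('I_m.+1 * b), borel_partition B &
        close_correlations (meas a) (act a) (eta alpha \x meas b)%E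
          (fun g ly => (ly.1, act b g ly.2)) F eps A B.

Definition stably_weakly_equivalent (R : realType) (Gamma : countGroupType)
    (a b : pmp_action R Gamma) : Prop :=
  stably_weakly_contained a b /\ stably_weakly_contained b a.

(* Subgroups of Gamma, inside the product space 2^Gamma. *)
Definition subgroups (Gamma : countGroupType) : set {ptws Gamma -> bool} :=
  [set H : {ptws Gamma -> bool} | group_closed (H : {pred Gamma})].

Definition Sub (Gamma : countGroupType) : Type := set_type (@subgroups Gamma).

Section Sub.
Variable Gamma : countGroupType.

HB.instance Definition _ := Topological.on (Sub Gamma).

Lemma subgroups_setT : (xpredT : {ptws Gamma -> bool}) \in @subgroups Gamma.
Proof. by rewrite inE; split. Qed.

HB.instance Definition _ :=
  isPointed.Build (Sub Gamma) (SigSub subgroups_setT).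

Lemma Sub_basis (U : set (Sub Gamma)) (H : Sub Gamma) : open U -> U H ->
  exists s : seq Gamma, forall K : Sub Gamma,
    (forall g, g \in s -> val K g = val H g) -> U K.
Proof.
case=> W oW <- WH.
pose cyl (s : seq Gamma) :=
  [set f : {ptws Gamma -> bool} | forall g, g \in s -> f g = val H g].
pose F : set_system {ptws Gamma -> bool} := filter_from [set: seq Gamma] cyl.
have FF : Filter F.
  apply: filter_from_filter; first by exists [::].
  move=> s t _ _; exists (s ++ t) => // f fst; split=> g gs;
  by apply: fst; rewrite mem_cat gs ?orbT.
have FH : F --> (val H : {ptws Gamma -> bool}).
  apply/cvg_sup => g U' [V [[B oB <-] VH] VU].
  exists [:: g] => // f fg; apply: VU => /=.
  by rewrite /= fg ?mem_head.
have [s _ sW] : F W := FH _ (open_nbhs_nbhs (conj oW WH)).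
by exists s => K Ks; apply: sW.
Qed.

End Sub.

Notation BorelSub Gamma := (g_sigma_algebraType (@open (Sub Gamma))).

Lemma countable_bigcap_measurable d (T : measurableType d) (I : Type)
    (D : set I) (F : I -> set T) :
  countable D -> (forall i, measurable (F i)) ->
  measurable (\bigcap_(i in D) F i).
Proof.
move=> cD mF; rewrite bigcap_set_type -[X in measurable X]setCK setC_bigcap.
apply/measurableC/countable_bigcupT_measurable; last first.
  by move=> i; exact: measurableC.
by rewrite (eq_countable (card_setT D)).
Qed.

Section Stabilizer.
Variables (R : realType) (Gamma : countGroupType) (a : pmp_action R Gamma).

Lemma stab_subproof (x : a) :
  ((fun g => act a g x == x) : {ptws Gamma -> bool}) \in @subgroups Gamma.
Proof.
rewrite inE; split; first by rewrite unfold_in /= act1.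
move=> g h; rewrite !unfold_in /= => /eqP gx /eqP hx.
by rewrite actM -[X in act _ _ (act _ _ X)]hx -(actM h^-1%g) mulVg act1 gx.
Qed.

Definition stab (x : a) : BorelSub Gamma := SigSub (stab_subproof x).

Lemma measurable_fix g : measurable [set x : a | act a g x = x].
Proof.
have [P [[[D cD dD] _] [f bijf mE]]] := standard_space a.
have openb q r : open [set y : P | mdist q y < r].
  rewrite openE => y /= qy; rewrite /interior.
  have r0 : 0 < r - mdist q y by rewrite subr_gt0.
  apply: filterS (nbhsx_ballx y _ r0) => z; rewrite ballEmdist/= => yz.
  by rewrite (le_lt_trans (metric_triangle q y z))// -ltrBrDl.
have mb q r : measurable [set x : a | mdist q (f x) < r].
  rewrite mE; exists [set y | mdist q y < r] => //.
  by apply: sub_gen_smallest; exact: openb.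
have mgb q r : measurable [set x : a | mdist q (f (act a g x)) < r].
  by rewrite -[X in measurable X]setTI; exact: (measurable_act (p:=a) g measurableT (mb q r)).
rewrite (_ : [set x | _] = \bigcap_(q in D) \bigcap_n
    (~` [set x : a | mdist q (f x) < n.+1%:R^-1] `|`
     [set x : a | mdist q (f (act a g x)) < n.+1%:R^-1])); last first.
  apply/seteqP; split=> [x /= gx q _ n _|x /= gx].
    by rewrite /= gx; case: (pselect (mdist q (f x) < n.+1%:R^-1)); [right|left].
  apply: (bij_inj bijf); apply: mdist_positivity; apply/eqP.
  rewrite eq_le mdist_ge0 andbT; apply/ler_addgt0Pr => e e0; rewrite add0r.
  have [n ne] : exists n, n.+1%:R^-1 < e / 2.
    have e2 : 0 < e / 2 by rewrite divr_gt0.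
    have /filter_ex[n] := near_infty_natSinv_lt (PosNum e2); by exists n.
  have [q [/= xq Dq]] : [set y | mdist (f x) y < n.+1%:R^-1] `&` D !=set0.
    by apply: dD; [exists (f x); rewrite /= mdistxx|exact: openb].
  have qx : mdist q (f x) < n.+1%:R^-1 by rewrite metric_sym.
  have [//|qgx] := gx q Dq n I; rewrite /= in qgx.
  rewrite (le_trans (metric_triangle _ q _))// (splitr e) lerD// ltW//.
    by rewrite metric_sym (lt_trans qgx).
  exact: lt_trans qx ne.
apply: countable_bigcap_measurable => // q.
by apply: bigcapT_measurable => n; apply: measurableU => //; exact: measurableC.
Qed.

Lemma measurable_stab : measurable_fun [set: a] stab.
Proof.
apply: (@measurability _ _ a (BorelSub Gamma) _ _ (@open (Sub Gamma))) => //.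
move=> _ [U oU <-]; rewrite setTI.
pose C (p : seq (Gamma * bool)) :=
  [set H : Sub Gamma | forall q, q \in p -> val H q.1 = q.2].
pose I := [set p | C p `<=` U].
have mC p : measurable (stab @^-1` C p).
  rewrite (_ : _ @^-1` _ = \bigcap_(q in [set` p])
     [set x | (act a q.1 x == x) = q.2]); last by [].
  apply: countable_bigcap_measurable; first exact: countableP.
  move=> [g []] /=.
    rewrite (_ : [set x | _] = [set x | act a g x = x]); first exact: measurable_fix.
    by apply/seteqP; split=> x /= /eqP.
  rewrite (_ : [set x | _] = ~` [set x | act a g x = x]).
    exact/measurableC/measurable_fix.
  by apply/seteqP; split=> x /=; case: eqP.
rewrite (_ : stab @^-1` U = \bigcup_(p in I) (stab @^-1` C p)).
  rewrite -[X in measurable X]setCK setC_bigcup; apply: measurableC.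
  apply: countable_bigcap_measurable; first exact: countableP.
  by move=> p; exact: measurableC.
apply/seteqP; split=> [x Ux|x [p Ip /Ip]//].
have [s sU] := Sub_basis oU Ux.
exists [seq (g, val (stab x) g) | g <- s]; last by move=> q /mapP[g gs ->].
by move=> K CK; apply: sU => g gs; apply: (CK (g, _)); apply/mapP; exists g.
Qed.

HB.instance Definition _ := isMeasurableFun.Build _ _ _ _ stab measurable_stab.

Definition action_type : probability (BorelSub Gamma) R :=
  distribution (meas a) stab.

End Stabilizer.

(* Measures in the library are functions on all sets, hence only their values
   on measurable sets are meaningful. *)
Definition same_type (R : realType) (Gamma : countGroupType)
    (a b : pmp_action R Gamma) : Prop :=
  forall S : set (BorelSub Gamma),
    measurable S -> action_type a S = action_type b S.

Definition infinite_index (Gamma : countGroupType) : set (BorelSub Gamma) :=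
  [set H : BorelSub Gamma |
    infinite_set [set [set (g * h)%g | h in [set h | val H h]] | g in [set: Gamma]]].

(* Main.v *)
(* Stable weak containment of a in b does not increase the measure of
   {x | g x <> x for all g in F}, F finite; these measures determine the type.

   Conversely, let a and b have the same type, and colour the space of a by a
   finite partition. Amenability gives group elements s_1, ..., s_q (Reiter's
   condition) such that, for g in a finite set, the multisets {s_r y} and
   {s_r (g y)} mostly agree for every point y of b. A random point of the
   multiset of y, its centre, is then selected by rejection sampling from one
   random sequence of proposals common to all points, so that y and g y mostly
   select the same centre. A proposal for the centre c also carries a point x
   of a, random conditionally on fixing the same words as c, and y = s_r^-1 c
   receives the colour of s_r^-1 x. Equality of types makes the expected
   correlations of this colouring of b close to those of a, which is stable
   weak containment with the random proposals as the extra coordinate. If b has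
   no atoms, which follows from infinite index, two independent points of b
   rarely have common centres, hence the correlations have small variance and
   some fixed sequence of proposals works. *)
Require Import Defs.
From HB Require Import structures.
From mathcomp Require Import all_boot all_order all_algebra.
From mathcomp Require Import all_classical all_reals all_analysis.
From mathcomp Require Import ring lra.

Set Implicit Arguments.
Unset Strict Implicit.
Unset Printing Implicit Defensive.

Import Order.TTheory GRing.Theory Num.Theory.
Import numFieldNormedType.Exports.

Local Open Scope classical_set_scope.
Local Open Scope ring_scope.

(** The actions need not be free, so a colouring read off an orbit of [a] makes sense on an orbit of
    [b] only if both have the same coincidences. Hence the condition on words: if [y] and [g y]
    select the same centre [c = s_r y = s_t (g y)], the word [s_t g s_r^-1] fixes [c], hence also
    [x], so that [s_t^-1 x = g (s_r^-1 x)] and the two colours received are those of a point of [a]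
    and of its translate by [g]. Rejection sampling is a coupling: two multisets select the same
    element with probability (sum of minima) / (sum of maxima) of multiplicities, which Reiter's
    condition makes close to 1. The probability space has to be finite, as stable weak containment
    asks for finitely many weights. So proposals name pieces of a finite partition of [b] instead of
    points, at the price of a small set where distinct points of an orbit are confused, and the
    number of trials is bounded. All estimates are lower bounds; they become two-sided because the
    correlations of a partition sum to 1. *)

(** * Small averages or a separating functional *)

Lemma greedy_sum_le (R : realFieldType) (D : finType) (I : Type)
    (u : I -> D -> R) (C : R) :
  (forall i, \sum_d u i d ^+ 2 <= C) ->
  (forall S : D -> R, exists i, \sum_d S d * u i d <= 0) ->
  forall t, exists2 s : seq I, size s = t &
    \sum_d (\sum_(i <- s) u i d) ^+ 2 <= C * t%:R.
Proof.
move=> uC uS; elim=> [|t [s st sC]].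
  by exists [::] => //; rewrite mulr0 big1// => d _; rewrite big_nil expr0n.
(* The new vector has nonpositive inner product with the running sum, so the squared norm grows by
   at most [C], and averages are of order [t^(-1/2)]. *)
have [i iS] := uS (fun d => \sum_(i <- s) u i d).
exists (i :: s); first by rewrite /= st.
under eq_bigr do rewrite big_cons sqrrD.
rewrite !big_split/=.
have -> : \sum_d u i d * (\sum_(j <- s) u j d) = \sum_d (\sum_(j <- s) u j d) * u i d.
  by apply: eq_bigr => d _; rewrite mulrC.
have := uC i; move: iS sC; rewrite -natr1 mulrDr mulr1.
by set x := \sum_d _; set y := \sum_d _ ^+ 2; set z := \sum_d _ ^+ 2; lra.
Qed.

(* The sequence is built greedily in the Euclidean norm from the vectors
   [v i - e * (+- delta_d)], whose averages approach 0 exactly when those of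
   [v i] approach the l1-ball of radius [e]. *)
Lemma small_average_or_separated (R : realType) (D : finType) (I : Type)
    (v : I -> D -> R) (M e : R) : I -> D -> 0 < e ->
  (forall i d, `|v i d| <= M) ->
  (exists q (s : seq I), [/\ (0 < q)%N, size s = q &
     \sum_d `|\sum_(i <- s) v i d| <= 2 * e * q%:R]) \/
  (exists2 f : D -> R, forall d, `|f d| <= 1 &
     forall i, e <= \sum_d f d * v i d).
Proof.
move=> i0 d0 e0 vM.
pose sg (b : bool) : R := (-1) ^+ b.
pose u (p : I * (D * bool)) d := v p.1 d - e * (sg p.2.2 *+ (d == p.2.1)).
have uM p d : `|u p d| <= M + e.
  rewrite /u (le_trans (ler_normB _ _))// lerD// normrM gtr0_norm//.
  case: eqP => _; first by rewrite mulr1n normr_sign mulr1.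
  by rewrite mulr0n normr0 mulr0 ltW.
have M0 : 0 <= M by exact: le_trans (vM i0 d0).
pose C := (M + e) ^+ 2 *+ #|D|.
have C0 : 0 <= C by rewrite mulrn_wge0// sqr_ge0.
have uC p : \sum_d u p d ^+ 2 <= C.
  rewrite /C -sumr_const; apply: ler_sum => d _.
  by rewrite -[_ ^+ 2]ger0_norm ?sqr_ge0// normrX lerXn2r// ?nnegrE// addr_ge0// ltW.
have [uS|] := pselect (forall S : D -> R, exists p, \sum_d S d * u p d <= 0).
  (* The inequality [2 |U| <= U^2 / eta + eta] passes from the Euclidean norm to the l1 norm. As
     [e * eta = C + 1], the first term sums to at most [e q]; a large [q] does the same for the
     second, [eta #|D|]. *)
  left; pose eta := (C + 1) / e.
  have eta0 : 0 < eta by rewrite divr_gt0// ltr_wpDl.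
  have [q q0 qe] : exists2 q, (0 < q)%N & eta * #|D|%:R <= e * q%:R.
    exists (Num.trunc (eta * #|D|%:R / e)).+1 => //.
    by rewrite [leRHS]mulrC -ler_pdivrMr// ltW// truncnS_gt.
  have [s sq sC] := greedy_sum_le uC uS q.
  exists q, [seq p.1 | p <- s]; split=> //; first by rewrite size_map.
  pose U d := \sum_(p <- s) u p d.
  pose E d := \sum_(p <- s) (sg p.2.2 *+ (d == p.2.1)).
  have vUE d : \sum_(i <- [seq p.1 | p <- s]) v i d = U d + e * E d.
    rewrite big_map /U /E mulr_sumr -big_split/=; apply: eq_bigr => p _.
    by rewrite /u subrK.
  have E1 : \sum_d `|E d| <= q%:R.
    apply: (@le_trans _ _ (\sum_d \sum_(p <- s) ((d == p.2.1)%:R : R))).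
      apply: ler_sum => d _; apply: (le_trans (ler_norm_sum _ _ _)).
      apply: ler_sum => p _; case: eqP => _; rewrite ?mulr1n ?mulr0n ?normr0//.
      by rewrite normr_sign.
    rewrite exchange_big/=.
    rewrite -sq -sum1_size natr_sum; apply: ler_sum => p _.
    by rewrite (bigD1 p.2.1)//= eqxx big1 ?addr0// => d /negbTE->.
  have U1 : \sum_d `|U d| <= e * q%:R.
    have UU d : `|U d| <= (U d ^+ 2 / eta + eta) / 2.
      rewrite ler_pdivlMr// -subr_ge0.
      have -> : U d ^+ 2 / eta + eta - `|U d| * 2 = (`|U d| - eta) ^+ 2 / eta.
        rewrite -(real_normK (num_real (U d))).
        by field; rewrite gt_eqF.
      by rewrite divr_ge0 ?sqr_ge0// ltW.
    apply: (le_trans (ler_sum _ (fun d _ => UU d))).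
    rewrite -mulr_suml big_split/= -mulr_suml sumr_const.
    have sC' : (\sum_d U d ^+ 2) / eta <= e * q%:R.
      have ee : e * eta = C + 1 by rewrite /eta mulrC divfK// gt_eqF.
      by rewrite ler_pdivrMr// mulrAC ee mulrDl mul1r (le_trans sC)// lerDl.
    by rewrite -[eta *+ _]mulr_natr; lra.
  under eq_bigr do rewrite vUE.
  apply: (@le_trans _ _ (\sum_d (`|U d| + e * `|E d|))).
    by apply: ler_sum => d _; rewrite (le_trans (ler_normD _ _))// normrM (gtr0_norm e0).
  rewrite big_split/= -mulr_sumr.
  have := ler_wpM2l (ltW e0) E1; lra.
(* A functional [S] positive on every [u], tested on the vector shifted at [d] in the direction of
   the sign of [S d], exceeds [e |S d|] on every [v i]. Dividing by the largest [|S d|] gives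
   [f]. *)
move=> /existsNP[S /forallNP nS]; right.
have {}nS i d : e * `|S d| < \sum_d0 S d0 * v i d0.
  have /negP := nS (i, (d, S d < 0)); rewrite -ltNge /u /=.
  under eq_bigr do rewrite mulrBr.
  rewrite sumrB subr_gt0; apply: le_lt_trans.
  rewrite (bigD1 d)//= eqxx mulr1n big1 ?addr0; last first.
    by move=> d' /negbTE->; rewrite mulr0n !mulr0.
  by rewrite /sg mulrCA [X in _ <= _ * X]mulrC -normrEsign.
pose d1 := [arg max_(d > d0) `|S d|]%O.
have Smax d : `|S d| <= `|S d1|.
  by rewrite /d1; case: arg_maxP => // d' _; exact.
have S0 : 0 < `|S d1|.
  rewrite lt_neqAle normr_ge0 andbT eq_sym normr_eq0; apply/eqP => S10.
  have := nS i0 d1; rewrite big1 ?S10 ?normr0 ?mulr0 ?ltxx// => d _.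
  by have := Smax d; rewrite S10 normr0 normr_le0 => /eqP->; rewrite mul0r.
exists (fun d => S d / `|S d1|) => [d|i].
  by rewrite normrM normfV normr_id ler_pdivrMr// mul1r.
under eq_bigr do rewrite mulrAC.
by rewrite -mulr_suml ler_pdivlMr// ltW.
Qed.

(** * Reiter's condition *)

Section Reiter.
Variables (R : realType) (Gamma : countGroupType).

Lemma ultra_limit (U : set_system nat) (f : nat -> R) : UltraFilter U ->
  (forall n, `|f n| <= 1) -> exists2 l : R, `|l| <= 1 & f @ U --> l.
Proof.
move=> UU f1.
have PU : ProperFilter U by exact: ultra_proper.
have f11 : (f @ U) `[(-1 : R), 1]%classic.
  by rewrite /= /nbhs/=; apply: filterE => n /=; rewrite in_itv/= -ler_norml f1.
have [l [/= l1 fl]] := @segment_compact R (-1) 1 (f @ U) _ f11.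
exists l; first by move: l1; rewrite in_itv/= -ler_norml.
move=> V lV; have [//|nV] := in_ultra_setVsetC (f @^-1` V) UU.
by have [x []] := fl (~` V) V nV lV.
Qed.

Definition norm_bounded (f : Gamma -> R) := exists M, forall g, `|f g| <= M.

Lemma norm_boundedD f1 f2 c : norm_bounded f1 -> norm_bounded f2 ->
  norm_bounded (fun g => c * f1 g + f2 g).
Proof.
move=> [M1 h1] [M2 h2]; exists (`|c| * M1 + M2) => g.
by rewrite (le_trans (ler_normD _ _))// lerD// normrM ler_wpM2l.
Qed.

(* The mean in the definition of amenability is left-invariant, hence the
   inversion of the argument below. *)
Lemma no_coboundary_gap (n : nat) (gs : 'I_n -> Gamma) (f : 'I_n -> Gamma -> R)
    (e : R) : amenable R Gamma -> 0 < e ->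
  (forall i g, `|f i g| <= 1) ->
  ~ (forall h, e <= \sum_i (f i (h * gs i)%g - f i h)).
Proof.
move=> [m [mD m_ge0 m1 mI]] e0 f1 ef.
pose B := norm_bounded.
have Bc c : B (fun=> c) by exists `|c|.
have m0 : m (fun=> 0) = 0.
  have E : (fun=> -1 * 1 + 1) = (fun=> 0) :> (Gamma -> R) by apply/funext => g; lra.
  by have := mD (-1) _ _ (Bc 1) (Bc 1); rewrite E m1 => ->; lra.
have B1 (F : Gamma -> R) : (forall g, `|F g| <= 1) -> B F by exists 1.
have Bsum (I : Type) (r : seq I) (F : I -> Gamma -> R) :
    (forall i, B (F i)) -> B (fun g => \sum_(i <- r) F i g).
  move=> BF; elim: r => [|i r IH].
    by under eq_fun do rewrite big_nil; exact: Bc.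
  under eq_fun do rewrite big_cons -[F i _]mul1r.
  exact: norm_boundedD (BF i) IH.
have msum (I : Type) (r : seq I) (F : I -> Gamma -> R) :
    (forall i, B (F i)) -> m (fun g => \sum_(i <- r) F i g) = \sum_(i <- r) m (F i).
  move=> BF; elim: r => [|i r IH].
    by rewrite big_nil -[RHS]m0; congr m; apply/funext => g; rewrite big_nil.
  rewrite big_cons -IH -[m (F i)]mul1r -mD; [|exact: BF|exact: Bsum].
  by congr m; apply/funext => g; rewrite big_cons mul1r.
pose G i g := f i (g^-1 * gs i)%g - f i g^-1%g.
have BG i : B (G i).
  by exists 2 => g; rewrite (le_trans (ler_normB _ _))// (_ : 2 = 1 + 1)// lerD.
have mG i : m (G i) = 0.
  pose k g := f i g^-1%g.
  have Bk : B k by apply: B1 => g; exact: f1.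
  have Bk' h : B (fun g => k (h * g)%g) by apply: B1 => g; exact: f1.
  have -> : G i = fun g => -1 * k g + k ((gs i)^-1 * g)%g.
    by apply/funext => g; rewrite /G /k invgM invgK; lra.
  have := mI (gs i)^-1%g k Bk; rewrite mD; [lra|exact: Bk|exact: Bk'].
have := m_ge0 (fun g => (- e) * 1 + \sum_(i <- index_enum 'I_n) G i g).
rewrite mD; [|exact: Bc|exact: Bsum]; rewrite msum// m1.
rewrite big1// => H; suff : e <= 0 by lra.
have : 0 <= - e * 1 + 0; last by lra.
apply: H => [|g]; first by apply: norm_boundedD; [exact: Bc|exact: Bsum].
by have := ef g^-1%g; rewrite /G; lra.
Qed.

(** If no tuple works, then over each finite window of [Gamma] the vectors
    [delta_(h gs_i) - delta_h] have no small average, hence are separated from 0 by functions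
    bounded by 1. The limit of these functions along an ultrafilter has a gap on all of [Gamma],
    which the mean excludes. *)
Lemma reiter (n : nat) (gs : 'I_n -> Gamma) (e : R) :
  amenable R Gamma -> 0 < e ->
  exists (q : nat) (s : q.-tuple Gamma), (0 < q)%N /\
    forall i (B : pred Gamma),
      (count B s)%:R <= (count (fun h => B (h * gs i)%g) s)%:R + e * q%:R.
Proof.
move=> am e0; pose e2 := e / 2; have e20 : 0 < e2 by rewrite divr_gt0.
apply: contrapT => noq.
pose H N : seq Gamma := pmap unpickle (iota 0 N).
have sep N : exists f : 'I_n -> Gamma -> R, (forall i g, `|f i g| <= 1) /\
    forall h, h \in H N -> e2 <= \sum_i (f i (h * gs i)%g - f i h).
  case: n gs noq => [gs noq|n gs noq].
    by exfalso; apply: noq; exists 1%N, [tuple 1%g]; split=> // -[].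
  have [H0|[h0 Hh0]] : H N = [::] \/ exists h, h \in H N.
    by case: (H N) => [|h l]; [left|right; exists h; rewrite mem_head].
    by exists (fun _ _ => 0); split=> [i g|h]; rewrite ?normr0// H0.
  pose L := H N ++ [seq (h * gs i)%g | h <- H N, i <- enum 'I_n.+1].
  have LH h : h \in H N -> h \in L by move=> hH; rewrite mem_cat hH.
  have LHg h i : h \in H N -> (h * gs i)%g \in L.
    move=> hH; rewrite mem_cat; apply/orP; right.
    by apply/allpairsP; exists (h, i); rewrite mem_enum.
  pose D := ('I_n.+1 * seq_sub L)%type.
  pose v (h : seq_sub (H N)) (d : D) : R :=
    (ssval d.2 == ssval h * gs d.1)%g%:R - (ssval d.2 == ssval h)%:R.
  have v2 h d : `|v h d| <= 2.
    by rewrite /v; do 2!case: eqP => _; rewrite ler_norml/=; lra.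
  have sumL (F : Gamma -> R) x : x \in L ->
      \sum_(l : seq_sub L) F (ssval l) * (ssval l == x)%:R = F x.
    move=> xL; rewrite (bigD1 (SeqSub xL))//= eqxx mulr1 big1 ?addr0// => l lx.
    by rewrite (_ : (_ == _) = false) ?mulr0//; apply: contraNF lx => /eqP lx; apply/eqP/val_inj.
  have [[q [s [q0 sq sv]]]|[f f1 ef]] := @small_average_or_separated R D _ v 2 e2
      (SeqSub Hh0) (ord0, SeqSub (LH _ Hh0)) e20 v2.
    exfalso; apply: noq.
    have st : size [seq ssval h | h <- s] == q by rewrite size_map sq.
    exists q, (Tuple st); split=> // i B.
    have countE (P : pred Gamma) :
        (count P [seq ssval h | h <- s])%:R = \sum_(h <- s) (P (ssval h))%:R :> R.
      rewrite count_map -sum1_count natr_sum big_mkcond/=.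
      by apply: eq_bigr => h _; case: (P _).
    rewrite -lerBlDl /= !countE -sumrB.
    have -> : e = 2 * e2 by rewrite /e2; lra.
    apply: le_trans sv.
    (* The difference of the two counts pairs row [i] of the sum of the [v h] with the indicator of
       [B], which is bounded by 1; the l1 bound on all rows thus serves every [B] at once. *)
    pose bB l : R := (B l)%:R.
    have vB : \sum_(h <- s) (bB (ssval h) - bB (ssval h * gs i)%g) =
        - \sum_(l : seq_sub L) bB (ssval l) * \sum_(h <- s) v h (i, l).
      under [in RHS]eq_bigr do rewrite mulr_sumr.
      rewrite exchange_big/= -sumrN; apply: eq_bigr => h _.
      rewrite /v/=; under eq_bigr do rewrite mulrBr.
      rewrite sumrB !sumL ?opprB//.
        by apply: LH; exact: (ssvalP h).
      by apply: LHg; exact: (ssvalP h).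
    rewrite vB (le_trans (ler_norm _))// normrN (le_trans (ler_norm_sum _ _ _))//.
    rewrite -(pair_bigA _ (fun i l => `|\sum_(h <- s) v h (i, l)|))/=.
    rewrite (bigD1 i)//= ler_wpDr//.
      by apply: sumr_ge0 => j _; apply: sumr_ge0.
    apply: ler_sum => l _; rewrite normrM ler_piMl// /bB.
    by case: (B _); rewrite ?normr1 ?normr0.
  exists (fun i g => if insub g is Some l then f (i, l) else 0); split.
    by move=> i g; case: insub => [l|]; rewrite ?normr0.
  move=> h hH; have := ef (SeqSub hH); rewrite /v/= => /le_trans; apply.
  pose fz i g := if insub g is Some l then f (i, l) else 0.
  have -> : \sum_d f d * ((ssval d.2 == h * gs d.1)%g%:R - (ssval d.2 == h)%:R) =
      \sum_i \sum_l f (i, l) * ((ssval l == h * gs i)%g%:R - (ssval l == h)%:R).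
    by rewrite pair_bigA; apply: eq_bigr => -[].
  apply: ler_sum => i _; under eq_bigr do rewrite mulrBr.
  rewrite -/(fz i _) -[X in _ - X]/(fz i h) -(sumL (fz i) _ (LH _ hH)) -(sumL (fz i) _ (LHg _ i hH)).
  rewrite -sumrB; apply: ler_sum => l _.
  by rewrite /fz -[ssval l]/(val l) valK.
pose f N := sval (cid (sep N)).
have f1 N i g : `|f N i g| <= 1 by exact: (svalP (cid (sep N))).1.
have fe N h : h \in H N -> e2 <= \sum_i (f N i (h * gs i)%g - f N i h).
  exact: (svalP (cid (sep N))).2.
have [U [UU ooU]] := @ultraFilterLemma nat \oo _.
have PU : ProperFilter U by exact: ultra_proper.
have fl i g : exists l : R, `|l| <= 1 /\ f N i g @[N --> U] --> l.
  by have [l l1 fl] := @ultra_limit U (fun N => f N i g) UU (fun N => f1 N i g); exists l.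
pose l i g := sval (cid (fl i g)).
have l1 i g : `|l i g| <= 1 by exact: (svalP (cid (fl i g))).1.
have lU i g : f N i g @[N --> U] --> l i g by exact: (svalP (cid (fl i g))).2.
apply: (no_coboundary_gap am e20 l1) => h.
apply: (@cvgr_to_ge _ U _ _ (fun N => \sum_i (f N i (h * gs i)%g - f N i h))).
  apply: cvg_big => [|i _]; [exact: add_continuous|exact: cvgB].
apply: ooU; exists (pickle h).+1 => // N /= hN; apply: fe.
rewrite /H mem_pmap; apply/mapP; exists (pickle h); last by rewrite pickleK.
by rewrite mem_iota.
Qed.
End Reiter.

(** * Rejection sampling *)

Section FirstAccepted.
Variables (R : realType) (Z : finType) (W : Z -> R).
Hypotheses (W_ge0 : forall z, 0 <= W z) (W1 : \sum_z W z = 1).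

Fixpoint trials (T : nat) : finType :=
  if T is T'.+1 then (Z * trials T')%type else unit.

Fixpoint trials_weight (T : nat) : trials T -> R :=
  if T is T'.+1 then fun w => W w.1 * trials_weight w.2 else fun=> 1.

Fixpoint first_accepted (K : Type) (d : K) (e : Z -> option K) (T : nat) :
    trials T -> K :=
  if T is T'.+1 then
    fun w => if e w.1 is Some k then k else first_accepted d e w.2
  else fun=> d.

Definition expect (T : nat) (f : trials T -> R) :=
  \sum_w trials_weight w * f w.

Lemma trials_weight_ge0 T (w : trials T) : 0 <= trials_weight w.
Proof. by elim: T w => [|T IH] //= w; rewrite mulr_ge0. Qed.

Lemma expectS T (f : trials T.+1 -> R) :
  expect f = \sum_z W z * @expect T (fun w => f (z, w)).
Proof.
rewrite /expect; under [RHS]eq_bigr do rewrite mulr_sumr.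
rewrite (pair_bigA _ (fun z w => W z * (trials_weight w * f (z, w))))/=.
by apply: eq_bigr => -[z w] _; rewrite mulrA.
Qed.

Lemma expect0 (f : trials 0 -> R) : expect f = f tt.
Proof. by rewrite /expect (big_pred1 tt) ?mul1r// => -[]. Qed.

Lemma sum_trials_weight T : \sum_(w : trials T) trials_weight w = 1.
Proof.
have -> : \sum_(w : trials T) trials_weight w = @expect T (fun=> 1).
  by apply: eq_bigr => w _; rewrite mulr1.
elim: T => [|T IH]; first by rewrite expect0.
by rewrite expectS; under eq_bigr do rewrite IH mulr1.
Qed.

Definition accept_prob (e : Z -> option bool) := \sum_(z | e z != None) W z.
Definition success_prob (e : Z -> option bool) := \sum_(z | e z == Some true) W z.

Lemma success_prob_ge0 e : 0 <= success_prob e.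
Proof. exact: sumr_ge0. Qed.

Lemma success_le_accept e : success_prob e <= accept_prob e.
Proof.
rewrite /success_prob /accept_prob big_mkcond [leRHS]big_mkcond.
by apply: ler_sum => z _; case: (e z) => [[]|] /=; rewrite ?W_ge0.
Qed.

Lemma accept_prob_le1 e : accept_prob e <= 1.
Proof.
rewrite -W1 /accept_prob big_mkcond.
by apply: ler_sum => z _; case: ifP.
Qed.

Definition success_by (e : Z -> option bool) T :=
  @expect T (fun w => (first_accepted false e w)%:R).

Lemma success_byS e T :
  success_by e T.+1 = success_prob e + (1 - accept_prob e) * success_by e T.
Proof.
have -> : 1 - accept_prob e = \sum_z (W z - (if e z != None then W z else 0)).
  by rewrite sumrB W1 -big_mkcond.
rewrite /success_by expectS /success_prob [X in _ = X + _]big_mkcond mulr_suml -big_split/=.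
apply: eq_bigr => z _; case: (e z) => [[]|] /=.
- rewrite subrr mul0r addr0 -[RHS]mulr1; congr (_ * _); rewrite -[RHS](sum_trials_weight T).
  by apply: eq_bigr => w _; rewrite mulr1.
- by rewrite subrr mul0r addr0 /expect big1 ?mulr0// => w _; rewrite mulr0.
- by rewrite subr0 add0r.
Qed.

(** A geometric series: some trial is accepted with probability [1 - (1 - accept_prob e) ^+ T], and
    the first such is positive with conditional probability [success_prob e / accept_prob e].
    Without division, tests that accept nothing are covered. *)
Lemma success_byE e T : accept_prob e * success_by e T =
  success_prob e * (1 - (1 - accept_prob e) ^+ T).
Proof.
elim: T => [|T IH]; first by rewrite /success_by expect0 expr0 subrr !mulr0.
by rewrite success_byS mulrDr mulrCA IH exprS; ring.
Qed.

Lemma success_by_ge0 e T : 0 <= success_by e T.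
Proof. by apply: sumr_ge0 => w _; rewrite mulr_ge0 ?trials_weight_ge0. Qed.

(* Tests with disjoint supports are decided at different trials, hence
   independently, but for the bound T on the number of trials. *)
Lemma joint_success_le (e e' : Z -> option bool) T :
  (forall z, e z = None \/ e' z = None) ->
  accept_prob e * accept_prob e' *
    @expect T (fun w => (first_accepted false e w && first_accepted false e' w)%:R)
  <= success_prob e * success_prob e'.
Proof.
move=> ee'; pose p := accept_prob e; pose p' := accept_prob e'.
pose b := success_prob e; pose b' := success_prob e'.
have b0 : 0 <= b by exact: success_prob_ge0.
have b'0 : 0 <= b' by exact: success_prob_ge0.
have bp : b <= p by exact: success_le_accept.
have bp' : b' <= p' by exact: success_le_accept.
have pp' : p + p' <= 1.
  rewrite -W1 /p /p' /accept_prob big_mkcond [X in _ + X]big_mkcond -big_split/=.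
  apply: ler_sum => z _; case: (ee' z) => -> /=; case: (_ != None);
  by rewrite ?addr0 ?add0r.
have u_le E S : accept_prob E * success_by E S <= success_prob E.
  rewrite success_byE ler_piMr ?success_prob_ge0// gerBl exprn_ge0// subr_ge0.
  exact: accept_prob_le1.
rewrite -/p -/p' -/b -/b'; elim: T => [|T IH].
  by rewrite expect0 /= mulr0 mulr_ge0.
set w := expect _ in IH.
(* By the first trial: if one test decides there positively, the other must succeed in the remaining
   [T] trials; with probability [1 - p - p'], by disjointness, neither decides and both go on. *)
have -> : @expect T.+1 (fun w => (first_accepted false e w && first_accepted false e' w)%:R)
    = b * success_by e' T + b' * success_by e T + (1 - p - p') * w.
  transitivity (\sum_z ((if e z == Some true then W z else 0) * success_by e' T +
      (if e' z == Some true then W z else 0) * success_by e T +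
      (W z - (if e z != None then W z else 0) - (if e' z != None then W z else 0)) * w)).
    rewrite expectS; apply: eq_bigr => z _ /=.
    case: (ee' z) => -> /=.
      case: (e' z) => [[]|] /=; rewrite ?subr0 ?subrr; do ?rewrite mul0r;
        rewrite ?addr0 ?add0r//.
        by congr (_ * _); apply: eq_bigr => x _; rewrite andbT.
      by rewrite /expect big1 ?mulr0// => x _; rewrite andbF mulr0.
    case: (e z) => [[]|] /=; rewrite ?subr0 ?subrr; do ?rewrite mul0r;
        rewrite ?addr0 ?add0r//.
    by rewrite /expect big1 ?mulr0// => x _; rewrite mulr0.
  by rewrite !big_split/= -!mulr_suml !sumrB -!big_mkcond W1.
have := u_le e T; have := u_le e' T; rewrite -/p -/p' -/b -/b'.
move: IH (success_by e T) (success_by e' T) => IH u u' u'b ub.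
have p0 : 0 <= p by exact: le_trans bp.
have p'0 : 0 <= p' by exact: le_trans bp'.
have h1 : p * b * (p' * u') <= p * b * b' by rewrite ler_wpM2l ?mulr_ge0.
have h2 : p' * b' * (p * u) <= p' * b' * b by rewrite ler_wpM2l ?mulr_ge0.
have h3 : (1 - p - p') * (p * p' * w) <= (1 - p - p') * (b * b').
  by rewrite ler_wpM2l//; lra.
have -> : p * p' * (b * u' + b' * u + (1 - p - p') * w) =
  p * b * (p' * u') + p' * b' * (p * u) + (1 - p - p') * (p * p' * w) by ring.
have -> : b * b' = p * b * b' + p' * b' * b + (1 - p - p') * (b * b') by ring.
by rewrite !lerD.
Qed.

End FirstAccepted.

Definition fin_measurable d (T : measurableType d) (S : finType) (f : T -> S) :=
  forall s, measurable [set x | f x = s].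

(** * Finite-valued measurable maps *)

Section FinMeasurable.
Context d (T : measurableType d).

Lemma fin_measurable_pred (S : finType) (f : T -> S) (Q : set S) :
  fin_measurable f -> measurable [set x | Q (f x)].
Proof.
move=> mf; rewrite (_ : [set x | _] = \bigcup_(s in Q) [set x | f x = s]).
  by apply: fin_bigcup_measurable => //; exact: finite_finset.
by apply/seteqP; split=> [x Qx|x [s Qs /= xs]]; [exists (f x)|rewrite /= xs].
Qed.

Lemma fin_measurable_comp (S S' : finType) (f : T -> S) (h : S -> S') :
  fin_measurable f -> fin_measurable (fun x => h (f x)).
Proof. by move=> mf s; exact: (fin_measurable_pred [set t | h t = s] mf). Qed.

Lemma fin_measurable_pair (S S' : finType) (f : T -> S) (f' : T -> S') :
  fin_measurable f -> fin_measurable f' -> fin_measurable (fun x => (f x, f' x)).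
Proof.
move=> mf mf' [s s'].
rewrite (_ : [set x | _] = [set x | f x = s] `&` [set x | f' x = s']).
  exact: measurableI.
by apply/seteqP; split=> x /= [E1 E2]; [split|rewrite E1 E2].
Qed.

Lemma fin_measurable_ffun (I S : finType) (f : I -> T -> S) :
  (forall i, fin_measurable (f i)) -> fin_measurable (fun x => [ffun i => f i x]).
Proof.
move=> mf s.
rewrite (_ : [set x | _] = \bigcap_(i in [set: I]) [set x | f i x = s i]).
  rewrite -[X in measurable X]setCK setC_bigcap; apply: measurableC.
  apply: fin_bigcup_measurable => [|i _]; first exact: finite_finset.
  exact/measurableC/mf.
apply/seteqP; split=> [x /= <- i _|x fx]; first by rewrite /= ffunE.
by apply/ffunP => i; rewrite ffunE; exact: fx.
Qed.

Lemma fin_measurable_bool (E : set T) : measurable E -> fin_measurable (fun x => `[< E x >]).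
Proof.
move=> mE s; case: s.
  by rewrite (_ : [set x | _] = E)//; apply/seteqP; split=> x /= /asboolP.
rewrite (_ : [set x | _] = ~` E); first exact: measurableC.
by apply/seteqP; split=> x /= => [xE Ex|]; [rewrite asboolT in xE|exact: asboolF].
Qed.

Lemma fin_measurable_preimage d' (T' : measurableType d') (S : finType)
    (f : T -> S) (g : T' -> T) :
  measurable_fun setT g -> fin_measurable f -> fin_measurable (f \o g).
Proof. by move=> mg mf s; rewrite -[X in measurable X]setTI; exact: (mg measurableT _ (mf s)). Qed.

End FinMeasurable.

(** * Real-valued probabilities *)

Definition pr d (T : measurableType d) (R : realType) (P : probability T R)
  (E : set T) : R := fine (P E).

Section Probability.
Context d (T : measurableType d) (R : realType) (P : probability T R).

Lemma prE E : measurable E -> P E = (pr P E)%:E.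
Proof. by move=> mE; rewrite /pr fineK// fin_num_measure. Qed.

Lemma pr_ge0 E : 0 <= pr P E.
Proof. exact: fine_ge0. Qed.

Lemma pr_setT : pr P setT = 1.
Proof. by rewrite /pr probability_setT. Qed.

Lemma pr_set0 : pr P set0 = 0.
Proof. by rewrite /pr measure0. Qed.

Lemma pr_le E F : measurable E -> measurable F -> E `<=` F -> pr P E <= pr P F.
Proof.
move=> mE mF EF; rewrite -lee_fin -!prE//.
by apply: le_measure; rewrite ?inE.
Qed.

Lemma pr_le1 E : measurable E -> pr P E <= 1.
Proof. by move=> mE; rewrite -pr_setT pr_le. Qed.

Lemma prU E F : measurable E -> measurable F -> E `&` F = set0 ->
  pr P (E `|` F) = pr P E + pr P F.
Proof.
move=> mE mF EF; apply: EFin_inj; rewrite EFinD -!prE//; last exact: measurableU.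
exact: measureU.
Qed.

Lemma pr_setC E : measurable E -> pr P (~` E) = 1 - pr P E.
Proof.
move=> mE; apply/eqP; rewrite eq_sym subr_eq -pr_setT -(setvU E) prU//.
- exact: measurableC.
- exact: setICl.
Qed.

Lemma prU_le E F : measurable E -> measurable F -> pr P (E `|` F) <= pr P E + pr P F.
Proof.
move=> mE mF; rewrite -(setDUK (@subsetUl _ E F)) prU//.
- rewrite lerD2l pr_le//; first by apply: measurableD => //; exact: measurableU.
  by move=> x [[]].
- by apply: measurableD => //; exact: measurableU.
- by rewrite setDE setIA (setIC E) -setIA setICr setI0.
Qed.

Lemma pr_partition (S : finType) (f : T -> S) E :
  fin_measurable f -> measurable E ->
  pr P E = \sum_s pr P (E `&` [set x | f x = s]).
Proof.
move=> mf mE.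
suff H (l : seq S) : uniq l ->
    pr P (E `&` [set x | f x \in l]) = \sum_(s <- l) pr P (E `&` [set x | f x = s]).
  rewrite -H ?index_enum_uniq//; congr (pr P _).
  by apply/seteqP; split=> [x Ex|x []//]; split=> //=; rewrite mem_index_enum.
elim: l => [_|s l IH /= /andP[sl ul]].
  by rewrite big_nil (_ : _ `&` _ = set0) ?pr_set0//; apply/seteqP; split=> x [].
rewrite big_cons -IH// -prU.
- congr (pr P _); apply/seteqP; split=> x.
    by move=> [Ex]; rewrite /= in_cons => /orP[/eqP|]; [left|right].
  by move=> [[Ex /= ->]|[Ex /= xl]]; split=> //=; rewrite in_cons ?eqxx ?xl ?orbT.
- by apply: measurableI.
- by apply: measurableI => //; exact: (fin_measurable_pred [set s | s \in l]).
- by apply/seteqP; split=> // x /= [[_ ->] [_]]; rewrite (negbTE sl).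
Qed.

Lemma pr_fin_pred (S : finType) (f : T -> S) (Q : pred S) : fin_measurable f ->
  pr P [set x | Q (f x)] = \sum_(s | Q s) pr P [set x | f x = s].
Proof.
move=> mf; rewrite (pr_partition mf); last exact: (fin_measurable_pred (fun s => Q s) mf).
rewrite [RHS]big_mkcond; apply: eq_bigr => s _; case: ifPn => Qs.
  by congr (pr P _); apply/seteqP; split=> [x []//|x /= xs]; rewrite xs.
rewrite (_ : _ `&` _ = set0) ?pr_set0//.
by apply/seteqP; split=> // x /= [+ xs]; rewrite xs (negbTE Qs).
Qed.

Lemma sum_pr_fin (S : finType) (f : T -> S) : fin_measurable f ->
  \sum_s pr P [set x | f x = s] = 1.
Proof.
by move=> mf; rewrite -(pr_fin_pred xpredT mf) -pr_setT; congr (pr P _); apply/seteqP.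
Qed.

Lemma pr_bigcup_le (I : finType) (E : I -> set T) : (forall i, measurable (E i)) ->
  pr P (\bigcup_i E i) <= \sum_i pr P (E i).
Proof.
move=> mE; pose U (l : seq I) := \bigcup_(i in [set` l]) E i.
have mU l : measurable (U l) by apply: fin_bigcup_measurable.
suff H l : pr P (U l) <= \sum_(i <- l) pr P (E i).
  apply: (le_trans _ (H _)); apply: pr_le => //.
    by apply: fin_bigcup_measurable => //; exact: finite_finset.
  by move=> x [i _ Ei]; exists i => //=; rewrite mem_index_enum.
elim: l => [|i l IH].
  by rewrite big_nil (_ : U _ = set0) ?pr_set0//; apply/seteqP; split=> x // [].
rewrite big_cons; apply: (@le_trans _ _ (pr P (E i `|` U l))).
  apply: pr_le => //; first exact: measurableU.
  move=> x [j]; rewrite /= in_cons => /orP[/eqP ->|jl]; [by left|by right; exists j].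
by rewrite (le_trans (prU_le _ _))// lerD2l.
Qed.

Lemma pr_cvg0 (F : (set T)^nat) (e : R) :
  (forall n, measurable (F n)) -> (forall m n, (m <= n)%N -> F n `<=` F m) ->
  P (\bigcap_n F n) = 0%E -> 0 < e -> \forall n \near \oo, pr P (F n) < e.
Proof.
move=> mF niF F0 e0.
have : P (F n) @[n --> \oo] --> P (\bigcap_n F n).
  apply: nonincreasing_cvg_mu => //.
  - by rewrite ltey_eq fin_num_measure.
  - by apply: bigcapT_measurable.
  - by move=> m n mn; apply/subsetPset; exact: niF.
rewrite F0 => /fine_cvg /cvgrPdist_lt /(_ e e0).
apply: filterS => n; rewrite /= sub0r normrN ger0_norm//.
exact: pr_ge0.
Qed.

End Probability.

(** * Separating sequences and itineraries *)

(** The sets are preimages of balls of radius [1/(n+1)] about a countable dense set, indexed by the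
    codes of centre and radius. They allow points to be approximated by finite information. *)
Lemma standard_borel_separated (R : realType) d (X : measurableType d) :
  standard_borel R X -> exists E : nat -> set X,
    (forall n, measurable (E n)) /\
    (forall x y, (forall n, E n x <-> E n y) -> x = y).
Proof.
move=> [M [[[D cD dD] _] [f bijf mE]]].
have openb q r : open [set y : M | mdist q y < r].
  rewrite openE => y /= qy; rewrite /interior.
  have r0 : 0 < r - mdist q y by rewrite subr_gt0.
  apply: filterS (nbhsx_ballx y _ r0) => z; rewrite ballEmdist/= => yz.
  by rewrite (le_lt_trans (metric_triangle q y z))// -ltrBrDl.
have mb q r : measurable [set x : X | mdist q (f x) < r].
  rewrite mE; exists [set y | mdist q y < r] => //.
  by apply: sub_gen_smallest; exact: openb.
have /countable_injP[c cinj] := cD.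
pose B (p : nat * nat) : set X :=
  [set x | exists2 q, D q /\ c q = p.1 & mdist q (f x) < p.2.+1%:R^-1].
have mB p : measurable (B p).
  have [[q [Dq cq]]|nq] := pselect (exists q, D q /\ c q = p.1).
    rewrite (_ : B p = [set x | mdist q (f x) < p.2.+1%:R^-1])//.
    apply/seteqP; split=> x; last by exists q.
    move=> [q' [Dq' cq']]; rewrite (_ : q' = q)//.
    by apply: cinj; rewrite ?inE// cq' cq.
  rewrite (_ : B p = set0)//; apply/seteqP; split=> // x [q Dq _].
  by apply: nq; exists q.
pose E n := if @unpickle (nat * nat)%type n is Some p then B p else set0.
exists E; split=> [n|x y xy]; first by rewrite /E; case: unpickle.
have {}xy p : B p x -> B p y.
  by have := (xy (pickle p)).1; rewrite /E pickleK.
apply: (bij_inj bijf); apply: mdist_positivity; apply/eqP.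
rewrite eq_le mdist_ge0 andbT; apply/ler_addgt0Pr => e e0; rewrite add0r.
have [n ne] : exists n, n.+1%:R^-1 < e / 2.
  have e2 : 0 < e / 2 by rewrite divr_gt0.
  have /filter_ex[n] := near_infty_natSinv_lt (PosNum e2); by exists n.
have [q [/= xq Dq]] : [set y | mdist (f x) y < n.+1%:R^-1] `&` D !=set0.
  by apply: dD; [exists (f x); rewrite /= mdistxx|exact: openb].
have [|q' [Dq' /= cq'] yq] := xy (c q, n).
  by exists q => //=; rewrite metric_sym.
have -> : e = e / 2 + e / 2 by lra.
rewrite (le_trans (metric_triangle _ q _))// lerD ?(ltW (lt_trans xq ne))//.
rewrite (_ : q = q') ?(ltW (lt_trans yq ne))//.
by apply: cinj; rewrite ?inE.
Qed.

(** The atom of [x] in the partition generated by [E 0, ..., E (n-1)]; [n] acts as a resolution. *)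
Definition itinerary (X : Type) (E : nat -> set X) n (x : X) : {ffun 'I_n -> bool} :=
  [ffun i : 'I_n => `[< E i x >]].
Arguments itinerary {X} E n x.

Lemma itinerary_eqP (X : Type) (E : nat -> set X) n x y :
  itinerary E n x = itinerary E n y <-> forall i, (i < n)%N -> (E i x <-> E i y).
Proof.
split=> [/ffunP xy i lin|xy].
  by have := xy (Ordinal lin); rewrite !ffunE; exact: asbool_eq_equiv.
by apply/ffunP => i; rewrite !ffunE; apply: asbool_equiv_eq; exact: xy.
Qed.

Lemma itinerary_eqW (X : Type) (E : nat -> set X) m n x y : (m <= n)%N ->
  itinerary E n x = itinerary E n y -> itinerary E m x = itinerary E m y.
Proof.
move=> mn /itinerary_eqP xy; apply/itinerary_eqP => i im; apply: xy.
exact: leq_trans mn.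
Qed.

Lemma fin_measurable_itinerary d (X : measurableType d) (E : nat -> set X) n :
  (forall n, measurable (E n)) -> fin_measurable (itinerary E n).
Proof.
move=> mE; apply: fin_measurable_ffun => i; exact: fin_measurable_bool.
Qed.

Lemma measurable_eq_fin d (X : measurableType d) (S : finType) (f f' : X -> S) :
  fin_measurable f -> fin_measurable f' -> measurable [set x | f x = f' x].
Proof.
move=> mf mf'.
exact: (fin_measurable_pred [set p | p.1 = p.2] (fin_measurable_pair mf mf')).
Qed.

Section Action.
Context (R : realType) (Gamma : countGroupType) (a : pmp_action R Gamma).
Implicit Types g h : Gamma.

Lemma pr_act g E : measurable E -> pr (meas a) (act a g @^-1` E) = pr (meas a) E.
Proof. by move=> mE; rewrite /pr meas_act. Qed.

Lemma measurable_preimage_act g (E : set a) : measurable E -> measurable (act a g @^-1` E).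
Proof.
move=> mE; rewrite -[X in measurable X]setTI.
exact: (measurable_act (p:=a) g measurableT).
Qed.

Lemma fin_measurable_act (S : finType) (f : a -> S) g :
  fin_measurable f -> fin_measurable (fun x => f (act a g x)).
Proof. by move=> mf s; exact: measurable_preimage_act (mf s). Qed.

Lemma act_eqE g h x : act a g x = act a h x <-> act a (h^-1 * g)%g x = x.
Proof.
rewrite actM; split=> [->|E]; first by rewrite -actM mulVg act1.
by rewrite -{2}E -[RHS]actM mulgV act1.
Qed.

Lemma actK g x : act a g^-1%g (act a g x) = x.
Proof. by rewrite -actM mulVg act1. Qed.

Lemma actVK g x : act a g (act a g^-1%g x) = x.
Proof. by rewrite -actM mulgV act1. Qed.

Lemma measurable_act_eq g h : measurable [set x | act a g x = act a h x].
Proof.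
rewrite (_ : [set x | _] = [set x | act a (h^-1 * g)%g x = x]).
  exact: measurable_fix.
by apply/seteqP; split=> x /= /act_eqE.
Qed.

Variable E : nat -> set a.
Hypotheses (mE : forall n, measurable (E n))
  (sepE : forall x y, (forall n, E n x <-> E n y) -> x = y).

Definition confused g h n : set a :=
  [set x | itinerary E n (act a g x) = itinerary E n (act a h x) /\
           act a g x <> act a h x].

Lemma measurable_confused g h n : measurable (confused g h n).
Proof.
apply: measurableI; last exact/measurableC/measurable_act_eq.
by apply: measurable_eq_fin; apply: fin_measurable_act; exact: fin_measurable_itinerary.
Qed.

(** The confused sets decrease in [n], and their intersection is empty because the [E n] separate
    points. *)
Lemma near_not_confused g h (e : R) : 0 < e ->
  \forall n \near \oo, pr (meas a) (confused g h n) < e.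
Proof.
apply: pr_cvg0 => [n|m n mn x [xE xgh]|]; first exact: measurable_confused.
  by split=> //; exact: itinerary_eqW xE.
rewrite (_ : \bigcap_n _ = set0) ?measure0//; apply/seteqP; split=> // x nE.
have [_] := nE 0 I; apply; apply: sepE => n.
by have [/itinerary_eqP + _] := nE n.+1 I; apply.
Qed.

Lemma measurable_singleton x : measurable [set x : a].
Proof.
rewrite (_ : [set x] = \bigcap_n [set y | itinerary E n y = itinerary E n x]).
  by apply: bigcapT_measurable => n; exact: fin_measurable_itinerary.
apply/seteqP; split=> [y -> //|y yx]; apply: sepE => n.
by have /itinerary_eqP := yx n.+1 I; apply.
Qed.

(* The sum is the measure of a neighbourhood of the diagonal, which is null in
   the square of an atomless space. *)
Lemma near_small_pieces (e : R) : (forall x : a, meas a [set x] = 0%E) -> 0 < e ->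
  \forall n \near \oo, \sum_c pr (meas a) [set x | itinerary E n x = c] ^+ 2 < e.
Proof.
move=> at0 e0; pose P2 : probability (a * a)%type R := (meas a \x meas a)%E.
pose F n := [set p : a * a | itinerary E n p.1 = itinerary E n p.2].
have mit n : fin_measurable (itinerary E n) by exact: fin_measurable_itinerary.
have mF n : measurable (F n).
  by apply: measurable_eq_fin; apply: fin_measurable_preimage (mit n);
    [exact: measurable_fst|exact: measurable_snd].
have F0 : P2 (\bigcap_n F n) = 0%E.
  rewrite -[LHS]/(\int[meas a]_x (meas a \o xsection (\bigcap_n F n)) x)%E.
  rewrite integral0_eq// => x _ /=.
  rewrite (_ : xsection _ _ = [set x])// xsectionE.
  apply/seteqP; split=> [y /= xy|y /= -> n _]; last by [].
  by apply: sepE => n; have /itinerary_eqP /(_ n (ltnSn n)) [] := xy n.+1 I; split.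
have PF n : P2 (F n) = (\sum_c pr (meas a) [set x | itinerary E n x = c] ^+ 2)%:E.
  rewrite prE//; congr EFin.
  have mfst : fin_measurable (fun p : a * a => itinerary E n p.1).
    by apply: fin_measurable_preimage (mit n); exact: measurable_fst.
  rewrite (pr_partition _ mfst)//; apply: eq_bigr => c _.
  rewrite (_ : _ `&` _ = [set x | itinerary E n x = c] `*` [set x | itinerary E n x = c]).
    apply: EFin_inj; rewrite expr2 EFinM -!prE; try exact: mit; last first.
      by apply: measurableX; exact: mit.
    exact: (product_measure1E (meas a) (meas a) (mit n c) (mit n c)).
  apply/seteqP; split=> [[x y] /= [xy xc]|[x y] /= [xc yc]].
    by split=> //; rewrite -xy.
  by split=> //; rewrite /F/= xc yc.
have : P2 (F n) @[n --> \oo] --> P2 (\bigcap_n F n).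
  apply: nonincreasing_cvg_mu => //.
  - by rewrite ltey_eq fin_num_measure.
  - by apply: bigcapT_measurable.
  - by move=> m n mn; apply/subsetPset => p; exact: itinerary_eqW.
rewrite F0; under eq_cvg do rewrite PF.
move=> /fine_cvg /cvgrPdist_lt /(_ e e0).
apply: filterS => n; rewrite /= sub0r normrN ger0_norm//.
by apply: sumr_ge0 => c _; exact: sqr_ge0.
Qed.

End Action.

(** * Proposals of centres *)

Section Proposals.
Variables (R : realType) (q k : nat) (N C : finType) (n0 : N).
Variables (cond : N -> C -> R) (paint : C -> 'I_q -> 'I_k).
Hypotheses (cond_ge0 : forall n c, 0 <= cond n c)
  (cond1 : forall n, \sum_c cond n c = 1) (q_gt0 : (0 < q)%N).
Implicit Types t : {ffun 'I_q -> N}.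

Let proposal : finType := (N * 'I_q * C)%type.

(* A proposal consists of a piece n, an index j and a sample c. A point with m
   visits to the piece n accepts it when j < m, so that pieces are selected
   proportionally to the number of visits. *)
Definition proposal_weight (z : proposal) : R :=
  cond z.1.1 z.2 / (#|N| * q)%:R.

Lemma cardN_gt0 : (0 < #|N|)%N.
Proof. by apply/card_gt0P; exists n0. Qed.

Lemma cardNq_gt0 : 0 < (#|N| * q)%:R :> R.
Proof. by rewrite ltr0n muln_gt0 cardN_gt0. Qed.

Lemma proposal_weight_ge0 z : 0 <= proposal_weight z.
Proof. by rewrite divr_ge0// ltW// cardNq_gt0. Qed.

(** Summation over the index [j] turns the test [j < M n] into a factor [M n]: so multiplicities
    enter the probabilities of acceptance and success. *)
Lemma sum_proposal_weight (M : N -> nat) (F : N -> C -> R) :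
  (forall n, (M n <= q)%N) ->
  \sum_z proposal_weight z * (F z.1.1 z.2 * (z.1.2 < M z.1.1)%N%:R) =
  (\sum_n (M n)%:R * \sum_c cond n c * F n c) / (#|N| * q)%:R.
Proof.
move=> Mq; rewrite mulr_suml.
rewrite -(pair_bigA _ (fun p c => proposal_weight (p, c) * (F p.1 c * (p.2 < M p.1)%N%:R)))/=.
rewrite -(pair_bigA _ (fun n j => \sum_c proposal_weight (n, j, c) * (F n c * (j < M n)%N%:R)))/=.
apply: eq_bigr => n _.
rewrite (_ : (M n)%:R = \sum_(j < q) (j < M n)%N%:R :> R); last first.
  rewrite -natr_sum -big_mkcond/= (big_ord_narrow (Mq n)) sum1_card card_ord//.
rewrite !mulr_suml; apply: eq_bigr => j _.
rewrite mulr_sumr mulr_suml; apply: eq_bigr => c _.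
by rewrite /proposal_weight/=; ring.
Qed.

Lemma proposal_weight1 : \sum_z proposal_weight z = 1.
Proof.
have := @sum_proposal_weight (fun=> q) (fun _ _ => 1) (fun=> leqnn q).
under eq_bigr do rewrite ltn_ord !mulr1.
move=> ->; under eq_bigr do under eq_bigr do rewrite mulr1.
under eq_bigr do rewrite cond1 mulr1.
by rewrite /= sumr_const -[X in X / _]mulr_natl -natrM divff// gt_eqF// cardNq_gt0.
Qed.

Definition mult t (n : N) : nat := #|[pred r | t r == n]|.

Lemma mult_le t n : (mult t n <= q)%N.
Proof. by rewrite -[leqRHS]card_ord max_card. Qed.

Lemma sum_mult t : (\sum_n mult t n)%N = q.
Proof.
rewrite -[RHS]card_ord -sum1_card (partition_big t xpredT)//=.
by apply: eq_bigr => n _; rewrite sum1_card.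
Qed.

Lemma mult_gt0 t n : (0 < mult t n)%N = [exists r, t r == n].
Proof.
apply/card_gt0P/existsP => [[r]|[r tr]]; first by rewrite inE; exists r.
by exists r; rewrite inE.
Qed.

(** A point may visit a piece at several positions; one is singled out to read the colour. For
    discerned points the choice is immaterial, as the proof of [theta_le_agreement] shows. *)
Definition chosen t n := [pick r | t r == n].

Definition verdict t (z : proposal) : option 'I_k :=
  if (z.1.2 < mult t z.1.1)%N then omap (paint z.2) (chosen t z.1.1) else None.

Lemma chosen_some t n : (0 < mult t n)%N -> exists2 r, chosen t n = Some r & t r = n.
Proof.
rewrite mult_gt0 /chosen; case: pickP => [r /eqP|tn] => [tr _|/existsP[r]]; first by exists r.
by rewrite tn.
Qed.

Lemma verdict_eq_None t z : (verdict t z == None) = (mult t z.1.1 <= z.1.2)%N.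
Proof.
rewrite /verdict; case: ltnP => //= jt.
by have [r -> _] := chosen_some (leq_ltn_trans (leq0n _) jt).
Qed.

(* Decided at the first proposal accepted by one of the two points, and
   successful only if both accept it. *)
Definition joint_verdict (p : {ffun 'I_q -> N} * {ffun 'I_q -> N}) i j (z : proposal) :
    option bool :=
  match verdict p.1 z, verdict p.2 z with
  | None, None => None
  | v, v' => Some ((v == Some i) && (v' == Some j))
  end.

Lemma joint_verdict_eq_None p i j z : (joint_verdict p i j z == None) =
  (maxn (mult p.1 z.1.1) (mult p.2 z.1.1) <= z.1.2)%N.
Proof.
rewrite geq_max -!verdict_eq_None /joint_verdict.
by case: (verdict p.1 z); case: (verdict p.2 z).
Qed.

(** At a successful joint decision both points accept the same proposal, and both rejected all
    earlier ones; so it is the first acceptance of each. *)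
Lemma first_joint_verdict p i j d T (w : trials proposal T) :
  first_accepted false (joint_verdict p i j) w ->
  first_accepted d (verdict p.1) w = i /\ first_accepted d (verdict p.2) w = j.
Proof.
elim: T w => [//|T IH] [z w] /=; rewrite /joint_verdict.
case: (verdict p.1 z) => [i'|]; case: (verdict p.2 z) => [j'|] //=; last exact: IH.
- by move=> /andP[/eqP[->] /eqP[->]].
- by rewrite andbF.
Qed.

Definition agrees t t' i j n c : bool :=
  if (chosen t n, chosen t' n) is (Some r, Some r')
  then (paint c r == i) && (paint c r' == j) else false.

Definition agreement t t' i j n : R := \sum_c cond n c * (agrees t t' i j n c)%:R.

Lemma agreement_ge0 t t' i j n : 0 <= agreement t t' i j n.
Proof. by apply: sumr_ge0 => c _; rewrite mulr_ge0. Qed.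

Lemma agreement_le1 t t' i j n : agreement t t' i j n <= 1.
Proof.
rewrite -(cond1 n); apply: ler_sum => c _; rewrite ler_piMr//.
by case: agrees.
Qed.

Lemma accept_joint p i j : accept_prob proposal_weight (joint_verdict p i j) =
  (\sum_n (maxn (mult p.1 n) (mult p.2 n))%:R) / (#|N| * q)%:R.
Proof.
have := @sum_proposal_weight (fun n => maxn (mult p.1 n) (mult p.2 n)) (fun _ _ => 1).
under [in RHS]eq_bigr do under eq_bigr do rewrite mulr1.
under [in RHS]eq_bigr do rewrite cond1 mulr1.
move=> <-; last by move=> n; rewrite geq_max !mult_le.
rewrite /accept_prob big_mkcond; apply: eq_bigr => z _.
by rewrite joint_verdict_eq_None -ltnNge mul1r; case: ltnP; rewrite ?mulr1 ?mulr0.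
Qed.

Lemma success_joint p i j : success_prob proposal_weight (joint_verdict p i j) =
  (\sum_n (minn (mult p.1 n) (mult p.2 n))%:R * agreement p.1 p.2 i j n) / (#|N| * q)%:R.
Proof.
rewrite -sum_proposal_weight; last by move=> n; rewrite geq_min mult_le.
rewrite /success_prob big_mkcond; apply: eq_bigr => z _.
rewrite leq_min /joint_verdict /verdict /agrees.
case: (ltnP z.1.2 (mult p.1 z.1.1)) => [/(leq_ltn_trans (leq0n _)) /chosen_some[r -> _]|_] /=; last first.
  by rewrite mulr0 mulr0; case: (if _ then omap _ _ else _).
case: (ltnP z.1.2 (mult p.2 z.1.1)) => [/(leq_ltn_trans (leq0n _)) /chosen_some[r' -> _]|_] /=; last first.
  by rewrite !mulr0 andbF.
rewrite mulr1 -[Some _ == Some i]/(paint z.2 r == i) -[Some _ == Some j]/(paint z.2 r' == j).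
by case: (_ && _); rewrite /= ?mulr1 ?mulr0.
Qed.

Lemma sum_maxn_ge p : q%:R <= \sum_n (maxn (mult p.1 n) (mult p.2 n))%:R :> R.
Proof.
rewrite -natr_sum ler_nat -[leqLHS](sum_mult p.1).
by apply: leq_sum => n _; exact: leq_maxl.
Qed.

Lemma accept_joint_ge p i j :
  #|N|%:R^-1 <= accept_prob proposal_weight (joint_verdict p i j).
Proof.
rewrite accept_joint ler_pdivlMr ?cardNq_gt0// natrM mulKf ?sum_maxn_ge//.
by rewrite pnatr_eq0 -lt0n cardN_gt0.
Qed.

(** Bounds the probability that [T] proposals are all rejected by both points, each being accepted
    with probability at least [1/#|N|] by [accept_joint_ge]. *)
Definition failure T : R := (1 - #|N|%:R^-1) ^+ T.

Lemma success_by_joint_ge p i j T :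
  success_prob proposal_weight (joint_verdict p i j) /
    accept_prob proposal_weight (joint_verdict p i j)
  <= success_by proposal_weight (joint_verdict p i j) T + failure T.
Proof.
set e := joint_verdict p i j; set al := accept_prob _ e; set be := success_prob _ e.
have al_ge : #|N|%:R^-1 <= al by exact: accept_joint_ge.
have al0 : 0 < al by rewrite (lt_le_trans _ al_ge)// invr_gt0 ltr0n cardN_gt0.
have al1 : al <= 1 by apply: accept_prob_le1 => *; rewrite ?proposal_weight1// proposal_weight_ge0.
have beal : be <= al by apply: success_le_accept => *; exact: proposal_weight_ge0.
have be0 : 0 <= be by apply: success_prob_ge0 => *; exact: proposal_weight_ge0.
rewrite -(ler_pM2l al0) mulrDr success_byE ?proposal_weight1//.
rewrite -/al -/be mulrC divfK ?gt_eqF// mulrBr mulr1 -addrA lerDl addrC subr_ge0.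
rewrite ler_pM// ?exprn_ge0 ?subr_ge0//.
by rewrite /failure lerXn2r ?nnegrE ?subr_ge0// ?lerD2l ?lerN2// (le_trans al_ge).
Qed.

(** With unlimited trials the probability of success is [A / M], where [A] is the sum of minima
    weighted by agreement and [M] the sum of maxima. Since [q <= M <= q + e q] and [A <= M],
    replacing [M] by [q] costs at most [e]; the error term in the bound on [theta] costs the other
    [e]. *)
Lemma proposals_succeed p i j T (e theta : R) : 0 <= e ->
  \sum_n ((mult p.1 n)%:R - (minn (mult p.1 n) (mult p.2 n))%:R) <= e * q%:R ->
  theta <= \sum_n (minn (mult p.1 n) (mult p.2 n))%:R * agreement p.1 p.2 i j n + e * q%:R ->
  theta / q%:R <=
    success_by proposal_weight (joint_verdict p i j) T + failure T + 2 * e.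
Proof.
move=> e0 pe te; set A := \sum_n _ * agreement _ _ _ _ _ in te.
pose M : R := \sum_n (maxn (mult p.1 n) (mult p.2 n))%:R.
have q0 : 0 < q%:R :> R by rewrite ltr0n.
have qM : q%:R <= M by exact: sum_maxn_ge.
have M0 : 0 < M by exact: lt_le_trans qM.
have Mq : M <= q%:R + e * q%:R.
  apply: le_trans (lerD (lexx _) pe); rewrite -{1}(sum_mult p.2) natr_sum -big_split/=.
  apply: ler_sum => n _.
  have := congr1 (fun x => x%:R : R) (addn_min_max (mult p.1 n) (mult p.2 n)).
  by rewrite !natrD; lra.
have A0 : 0 <= A by apply: sumr_ge0 => n _; rewrite mulr_ge0// agreement_ge0.
have AM : A <= M.
  apply: ler_sum => n _; rewrite -[leRHS]mulr1 ler_pM// ?agreement_ge0 ?agreement_le1//.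
  by rewrite ler_nat leq_max geq_minl.
have := success_by_joint_ge p i j T.
rewrite accept_joint success_joint -/A -/M invfM invrK mulrACA mulVf ?mulr1; last first.
  by rewrite gt_eqF// cardNq_gt0.
move=> AMu; suff : A / q%:R <= A / M + e.
  have : theta / q%:R <= A / q%:R + e.
    by rewrite ler_pdivrMr// mulrDl divfK// gt_eqF.
  lra.
rewrite -lerBlDl.
have -> : A / q%:R - A / M = (A / M) * ((M - q%:R) / q%:R).
  by field; rewrite !gt_eqF.
rewrite -[leRHS]mul1r ler_pM//.
- by rewrite divr_ge0// ltW.
- by rewrite divr_ge0 ?subr_ge0// ltW.
- by rewrite ler_pdivrMr// mul1r.
- by rewrite ler_pdivrMr//; lra.
Qed.

End Proposals.

(** * Second moments and concentration *)

Section Concentration.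
Variables (R : realType) (Z : finType) (W : Z -> R).
Hypotheses (W_ge0 : forall z, 0 <= W z) (W1 : \sum_z W z = 1).
Variables (S : finType) (L : S -> R).
Hypotheses (L_ge0 : forall s, 0 <= L s) (L1 : \sum_s L s = 1).
Variables (e : S -> Z -> option bool) (T : nat) (rho : R).
Hypotheses (rho01 : 0 <= rho <= 1) (acc0 : forall s, 0 < accept_prob W (e s))
  (rhoe : forall s, success_prob W (e s) / accept_prob W (e s) <=
                    success_by W (e s) T + rho).

Definition overlap s s' := [exists z, (e s z != None) && (e s' z != None)].

Definition success_mass (w : trials Z T) : R :=
  \sum_s L s * (first_accepted false (e s) w)%:R.

Definition mean_success : R := \sum_s L s * success_by W (e s) T.

Lemma success_by_le1 s : success_by W (e s) T <= 1.
Proof.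
rewrite -[leRHS](sum_trials_weight W1 T); apply: ler_sum => w _.
by rewrite ler_piMr ?trials_weight_ge0// lern1 leq_b1.
Qed.

Lemma expect_success_mass : expect W success_mass = mean_success.
Proof.
rewrite /expect /success_mass; under eq_bigr do rewrite mulr_sumr.
rewrite exchange_big; apply: eq_bigr => s _.
by rewrite /success_by /expect mulr_sumr; apply: eq_bigr => w _; ring.
Qed.

(** Without a common proposal, two tests succeed together at most as often as if independent, up to
    truncation: [(u + rho) (u' + rho) <= u u' + 3 rho], all numbers being at most 1. Overlapping
    pairs are bounded by 1. *)
Lemma second_moment_le : expect W (fun w => success_mass w ^+ 2) <=
  mean_success ^+ 2 + 3 * rho + \sum_s \sum_s' L s * L s' * (overlap s s')%:R.
Proof.
have /andP[rho0 rho1] := rho01.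
pose w2 s s' := @expect _ _ W T
  (fun w => (first_accepted false (e s) w && first_accepted false (e s') w)%:R).
have -> : expect W (fun w => success_mass w ^+ 2) =
    \sum_s \sum_s' L s * L s' * w2 s s'.
  rewrite /expect /success_mass.
  transitivity (\sum_(w : trials Z T) \sum_s \sum_s' L s * L s' * (trials_weight W w *
      (first_accepted false (e s) w && first_accepted false (e s') w)%:R)).
    apply: eq_bigr => w _; rewrite expr2 mulr_suml mulr_sumr; apply: eq_bigr => s _.
    rewrite !mulr_sumr; apply: eq_bigr => s' _; rewrite -mulnb natrM; ring.
  rewrite exchange_big; apply: eq_bigr => s _.
  rewrite exchange_big; apply: eq_bigr => s' _.
  by rewrite -mulr_sumr.
have -> : mean_success ^+ 2 = \sum_s \sum_s' L s * L s' * (success_by W (e s) T * success_by W (e s') T).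
  rewrite expr2 mulr_suml; apply: eq_bigr => s _; rewrite mulr_sumr; apply: eq_bigr => s' _; ring.
have -> : 3 * rho = \sum_s \sum_s' L s * L s' * (3 * rho).
  under eq_bigr do rewrite -mulr_suml -mulr_sumr L1 mulr1.
  by rewrite -mulr_suml L1 mul1r.
rewrite -!big_split; apply: ler_sum => s _; rewrite -!big_split; apply: ler_sum => s' _ /=.
rewrite -!mulrDr ler_wpM2l ?mulr_ge0//.
have u0 := success_by_ge0 W_ge0 (e s) T; have u1 := success_by_le1 s.
have u'0 := success_by_ge0 W_ge0 (e s') T; have u'1 := success_by_le1 s'.
case: (boolP (overlap s s')) => /= [_|/existsPn/= ss'].
  apply: (@le_trans _ _ 1); last by rewrite lerDr addr_ge0 ?mulr_ge0.
  rewrite -[leRHS](sum_trials_weight W1 T); apply: ler_sum => w _.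
  by rewrite ler_piMr ?trials_weight_ge0// lern1 leq_b1.
have disj z : e s z = None \/ e s' z = None.
  by have := ss' z; case: (e s z) => [?|]; case: (e s' z) => [?|] //=; [right|left|left].
have := joint_success_le W_ge0 W1 T disj; rewrite -/(w2 s s') => wle.
have {}wle : w2 s s' <= (success_prob W (e s) / accept_prob W (e s)) *
                      (success_prob W (e s') / accept_prob W (e s')).
  by rewrite mulrACA -invfM ler_pdivlMr ?mulr_gt0// mulrC.
apply: (le_trans wle); rewrite addr0.
apply: (@le_trans _ _ ((success_by W (e s) T + rho) * (success_by W (e s') T + rho))).
  by rewrite ler_pM// divr_ge0// ?success_prob_ge0// ltW.
have := ler_wpM2r rho0 u1; have := ler_wpM2r rho0 u'1; have := ler_wpM2r rho0 rho1.
nra.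
Qed.

Lemma variance_le : expect W (fun w => (success_mass w - mean_success) ^+ 2) <=
  3 * rho + \sum_s \sum_s' L s * L s' * (overlap s s')%:R.
Proof.
have := second_moment_le; have := expect_success_mass.
move: mean_success => m Em le2.
have -> : expect W (fun w => (success_mass w - m) ^+ 2) =
    expect W (fun w => success_mass w ^+ 2) - 2 * m * expect W success_mass + m ^+ 2.
  have -> : m ^+ 2 = \sum_(w : trials Z T) trials_weight W w * m ^+ 2.
    by rewrite -mulr_suml sum_trials_weight// mul1r.
  rewrite /expect !mulr_sumr -sumrB -big_split/=.
  by apply: eq_bigr => w _; ring.
by rewrite Em; lra.
Qed.

End Concentration.

(** Chebyshev's inequality with a union bound over [K]: if every [w] violated some inequality, the
    squared deviations summed over [K] would be at least [eta ^+ 2] everywhere, hence in mean. *)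
Lemma exists_concentrated (R : realType) (Z : finType) (W : Z -> R) (T : nat)
    (K : finType) (f : K -> trials Z T -> R) (m : K -> R) (v eta : R) :
  (forall z, 0 <= W z) -> \sum_z W z = 1 -> 0 < eta ->
  (forall i, expect W (fun w => (f i w - m i) ^+ 2) <= v) ->
  #|K|%:R * v < eta ^+ 2 ->
  exists w, forall i, m i - eta <= f i w.
Proof.
move=> W0 W1 eta0 fv Kv; apply: contrapT => /forallNP nw.
suff : eta ^+ 2 <= #|K|%:R * v by rewrite leNgt Kv.
rewrite mulr_natl -sumr_const.
apply: (le_trans _ (ler_sum _ (fun i _ => fv i))).
rewrite /expect exchange_big/= -[leLHS]mul1r -(sum_trials_weight W1 T) mulr_suml.
apply: ler_sum => w _; rewrite -mulr_sumr ler_wpM2l ?trials_weight_ge0//.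
have /existsNP[i /negP] := nw w; rewrite -ltNge => fi.
rewrite (bigD1 i)//= ler_wpDr ?sumr_ge0//; first by move=> j _; exact: sqr_ge0.
rewrite -[leRHS]sqrrN lerXn2r ?nnegrE//; lra.
Qed.

Lemma sum_pr_comp d (X : measurableType d) (R : realType) (P : probability X R)
    (S S' : finType) (f : X -> S) (h : S -> S') (F : S' -> R) : fin_measurable f ->
  \sum_s pr P [set x | f x = s] * F (h s) =
  \sum_s' pr P [set x | h (f x) = s'] * F s'.
Proof.
move=> mf; rewrite (partition_big h xpredT)//=; apply: eq_bigr => s' _.
have := pr_fin_pred P (fun s => h s == s') mf.
rewrite (_ : [set x | _] = [set x | h (f x) = s']); last first.
  by apply/seteqP; split=> x /= /eqP.
by move=> ->; rewrite mulr_suml; apply: eq_bigr => s /eqP ->.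
Qed.

(** * Traces of stabilisers on finite families *)

Definition fix_pattern (R : realType) (Gamma : countGroupType) (c : pmp_action R Gamma)
    (I : finType) (h : I -> Gamma) (x : c) : {ffun I -> bool} :=
  [ffun i => act c (h i) x == x].

Lemma fin_measurable_fix_pattern (R : realType) (Gamma : countGroupType)
    (c : pmp_action R Gamma) (I : finType) (h : I -> Gamma) :
  fin_measurable (@fix_pattern R Gamma c I h).
Proof.
apply: fin_measurable_ffun => i.
rewrite (_ : (fun x => _) = (fun x => `[< [set x | act c (h i) x = x] x >])).
  exact/fin_measurable_bool/measurable_fix.
by apply/funext => x; apply/eqP/asboolP.
Qed.

Definition same_patterns (R : realType) (Gamma : countGroupType)
    (a b : pmp_action R Gamma) : Prop :=
  forall (I : finType) (h : I -> Gamma) (tau : {ffun I -> bool}),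
    pr (meas a) [set x | fix_pattern h x = tau] =
    pr (meas b) [set y | fix_pattern h y = tau].

(** * Transferring a colouring from a to b *)

Section Transfer.
Context (R : realType) (Gamma : countGroupType) (a b : pmp_action R Gamma).
Hypothesis ab : same_patterns a b.
Variables (k : nat) (colour : a -> 'I_k).
Hypothesis mcolour : fin_measurable colour.
Variables (m : nat) (gs : 'I_m -> Gamma) (q : nat) (s : 'I_q -> Gamma) (e : R).
Hypotheses (q_gt0 : (0 < q)%N) (e_ge0 : 0 <= e).
Hypothesis reiter_s : forall l (B : pred Gamma),
  #|[pred r | B (s r)]|%:R <= #|[pred r | B (s r * gs l)%g]|%:R + e * q%:R :> R.
Variables (E : nat -> set b) (res : nat).
Hypothesis mE : forall n, measurable (E n).

Let word_index : finType := ('I_q * 'I_q * 'I_m)%type.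
(** The word of index [(r, r', l)] fixes the centre [s r' y] exactly when [s r (gs l y) = s r' y]:
    patterns of centres record the coincidences between positions of [y] and of [gs l y]. *)
Let word (p : word_index) : Gamma := (s p.1.1 * gs p.2 * (s p.1.2)^-1)%g.
Let pattern : finType := {ffun word_index -> bool}.
Let piece : finType := ({ffun 'I_res -> bool} * pattern)%type.
Let sample : finType := ({ffun 'I_q -> 'I_k} * pattern)%type.

Definition piece_of (y : b) : piece := (itinerary E res y, fix_pattern word y).

Definition sample_of (x : a) : sample :=
  ([ffun r => colour (act a (s r)^-1%g x)], fix_pattern word x).

Definition pattern_pr (tau : pattern) := pr (meas a) [set x | fix_pattern word x = tau].

Definition sample_pr (c : sample) := pr (meas a) [set x | sample_of x = c].

(* The unconditional law when the pattern is null, to remain a probability. *)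
Definition cond_pr (n : piece) (c : sample) : R :=
  if pattern_pr n.2 == 0 then sample_pr c
  else if c.2 == n.2 then sample_pr c / pattern_pr n.2 else 0.

Definition paint_of (c : sample) (r : 'I_q) := c.1 r.

Lemma fin_measurable_piece_of : fin_measurable piece_of.
Proof.
apply: fin_measurable_pair; first exact: fin_measurable_itinerary.
exact: fin_measurable_fix_pattern.
Qed.

Lemma fin_measurable_sample_of : fin_measurable sample_of.
Proof.
apply: fin_measurable_pair; last exact: fin_measurable_fix_pattern.
by apply: fin_measurable_ffun => r; exact: fin_measurable_act.
Qed.

Lemma cond_pr_ge0 n c : 0 <= cond_pr n c.
Proof.
rewrite /cond_pr; case: ifP => _; first exact: pr_ge0.
by case: ifP => _ //; rewrite divr_ge0// pr_ge0.
Qed.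

Lemma sum_cond_pr n : \sum_c cond_pr n c = 1.
Proof.
rewrite /cond_pr; case: (eqVneq (pattern_pr n.2) 0) => n0.
  exact/sum_pr_fin/fin_measurable_sample_of.
rewrite -big_mkcond/= -mulr_suml.
rewrite -(pr_fin_pred _ (fun c : sample => c.2 == n.2) fin_measurable_sample_of).
rewrite (_ : [set x | _] = [set x | fix_pattern word x = n.2]) ?divff//.
by apply/seteqP; split=> x /= /eqP.
Qed.

Definition stat (y : b) : {ffun 'I_q -> piece} := [ffun r => piece_of (act b (s r) y)].

Definition stat2 l (y : b) := (stat y, stat (act b (gs l) y)).

Lemma fin_measurable_stat : fin_measurable stat.
Proof.
by apply: fin_measurable_ffun => r; apply: fin_measurable_act; exact: fin_measurable_piece_of.
Qed.

Lemma fin_measurable_stat2 l : fin_measurable (stat2 l).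
Proof.
apply: fin_measurable_pair; first exact: fin_measurable_stat.
by apply: fin_measurable_act; exact: fin_measurable_stat.
Qed.

(* Equality of pieces is all that the random colouring sees of the equality of
   points of the orbit. *)
Definition discerned l (y : b) := forall r r',
  piece_of (act b (s r) y) = piece_of (act b (s r' * gs l)%g y) ->
  act b (s r) y = act b (s r' * gs l)%g y.

(** The conditional probability of the wanted colours given the pattern [tau] of the centre, seen
    from position [r]. It is 0 for null [tau], as division by 0 gives 0. *)
Definition theta i j l r (tau : pattern) : R :=
  pr (meas a) [set x | [/\ colour (act a (s r)^-1%g x) = i,
     colour (act a (gs l * (s r)^-1)%g x) = j & fix_pattern word x = tau]] / pattern_pr tau.

Lemma measurable_theta i j l r tau :
  measurable [set x | [/\ colour (act a (s r)^-1%g x) = i,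
     colour (act a (gs l * (s r)^-1)%g x) = j & fix_pattern word x = tau]].
Proof.
rewrite (_ : [set x | _] = [set x | colour (act a (s r)^-1%g x) = i] `&`
     [set x | colour (act a (gs l * (s r)^-1)%g x) = j] `&` [set x | fix_pattern word x = tau]).
  apply: measurableI; last exact: fin_measurable_fix_pattern.
  by apply: measurableI; exact: (fin_measurable_act _ mcolour).
by apply/seteqP; split=> [x [? ? ?]//|x [[]]//].
Qed.

Lemma theta_numerator_le i j l r tau : pr (meas a)
  [set x | [/\ colour (act a (s r)^-1%g x) = i,
     colour (act a (gs l * (s r)^-1)%g x) = j & fix_pattern word x = tau]] <= pattern_pr tau.
Proof.
apply: pr_le; [exact: measurable_theta|exact: fin_measurable_fix_pattern|].
by move=> x [].
Qed.

Lemma theta_le1 i j l r tau : theta i j l r tau <= 1.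
Proof.
rewrite /theta; have [->|n0] := eqVneq (pattern_pr tau) 0; first by rewrite invr0 mulr0.
rewrite ler_pdivrMr ?mul1r ?theta_numerator_le//.
by rewrite lt_neqAle eq_sym n0 pr_ge0.
Qed.

Lemma theta_mulr i j l r tau : pattern_pr tau * theta i j l r tau = pr (meas a)
  [set x | [/\ colour (act a (s r)^-1%g x) = i,
     colour (act a (gs l * (s r)^-1)%g x) = j & fix_pattern word x = tau]].
Proof.
have := theta_numerator_le i j l r tau; rewrite /theta mulrC.
have [->|n0 _] := eqVneq (pattern_pr tau) 0; last by rewrite divfK.
by rewrite mulr0 => le0; apply/eqP; rewrite eq_le le0 pr_ge0.
Qed.

(** Let [r1] and [r2] be the positions chosen by [y] and [gs l y] in the piece [n]. As [y] is
    discerned, [s r y], [s r1 y] and [s r2 (gs l y)] are one point. Its pattern, shared by the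
    sampled [x], forces [(s r1)^-1 x = (s r)^-1 x] and [(s r2)^-1 x = gs l ((s r)^-1 x)], so the
    colours read are those that [theta] counts. *)
Lemma theta_le_agreement i j l y r n : discerned l y -> stat y r = n ->
  (0 < mult (stat (act b (gs l) y)) n)%N ->
  theta i j l r n.2 <= agreement cond_pr paint_of (stat y) (stat (act b (gs l) y)) i j n.
Proof.
move=> gy yr mult_n; have mult_y : (0 < mult (stat y) n)%N.
  by rewrite mult_gt0; apply/existsP; exists r; rewrite yr.
have [r1 c1 yr1] := chosen_some mult_y; have [r2 c2 yr2] := chosen_some mult_n.
rewrite /agreement /agrees c1 c2 /theta /cond_pr.
have [n0|n0] := eqVneq (pattern_pr n.2) 0.
  rewrite n0 invr0 mulr0; apply: sumr_ge0 => c _.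
  by rewrite mulr_ge0// pr_ge0.
pose Q (c : sample) := [&& c.2 == n.2, c.1 r1 == i & c.1 r2 == j].
have -> : \sum_c (if c.2 == n.2 then sample_pr c / pattern_pr n.2 else 0) *
    ((paint_of c r1 == i) && (paint_of c r2 == j))%:R =
    (\sum_(c | Q c) sample_pr c) / pattern_pr n.2.
  rewrite mulr_suml [RHS]big_mkcond; apply: eq_bigr => c _; rewrite /Q /paint_of.
  by case: eqP => _ /=; rewrite ?mul0r//; case: (_ && _); rewrite ?mulr1 ?mulr0.
rewrite -(pr_fin_pred _ Q fin_measurable_sample_of) ler_wpM2r ?invr_ge0 ?pr_ge0//.
apply: pr_le; first exact: measurable_theta.
  exact: (fin_measurable_pred (fun c => Q c) fin_measurable_sample_of).
move=> x [xi xj xn].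
have st r0 y0 : stat y0 r0 = piece_of (act b (s r0) y0) by rewrite /stat ffunE.
have E2 : act b (s r) y = act b (s r2 * gs l)%g y.
  by apply: gy; rewrite actM -!st yr yr2.
have E1 : act b (s r1) y = act b (s r2 * gs l)%g y.
  by apply: gy; rewrite actM -!st yr1 yr2.
(* The word of index [(r2, r3, l)] fixes the centre [s r3 y]; it therefore fixes [x], which has the
   same pattern. *)
have fixx r3 : act b (s r3) y = act b (s r2 * gs l)%g y -> act a (s r2 * gs l * (s r3)^-1)%g x = x.
  move=> E3; have := congr1 (fun t : pattern => t (r2, r3, l)) xn.
  rewrite -yr st /piece_of /= !ffunE /word/= => fE; apply/eqP; rewrite fE.
  by rewrite {1}(etrans E2 (esym E3)) -actM -mulgA mulVg mulg1 E2 eqxx.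
rewrite /Q /= !ffunE xn eqxx /=.
have xr2 r3 : act b (s r3) y = act b (s r2 * gs l)%g y ->
    act a (gs l * (s r3)^-1)%g x = act a (s r2)^-1%g x.
  by move=> /fixx {2}<-; rewrite -actM !mulgA mulVg mul1g.
have -> : act a (s r1)^-1%g x = act a (s r)^-1%g x.
  have := xr2 _ E1; rewrite -(xr2 _ E2) !actM => /(congr1 (act a (gs l)^-1%g)).
  by rewrite !actK.
by rewrite xi eqxx -(xr2 _ E2) xj eqxx.
Qed.

Lemma sum_mult_pred (N : finType) (t : 'I_q -> N) (U : pred N) :
  (\sum_(n | U n) mult [ffun r => t r] n)%N = #|[pred r | U (t r)]|.
Proof.
rewrite -sum1_card (partition_big t U)//=; apply: eq_bigr => n Un.
rewrite /mult -sum1_card; apply: eq_bigl => r.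
by rewrite !inE ffunE; case: eqP => [->|_]; rewrite ?Un ?andbF.
Qed.

(** Reiter's condition for the set of [h] such that [h y] lies in a piece visited more often by [y]
    than by [gs l y]: the excess over this set is the sum of all positive parts. *)
Lemma mult_reiter l y :
  \sum_n ((mult (stat y) n)%:R -
    (minn (mult (stat y) n) (mult (stat (act b (gs l) y)) n))%:R) <= e * q%:R.
Proof.
set M := mult (stat y); set M' := mult (stat (act b (gs l) y)).
pose U n := (M' n < M n)%N.
have MU : #|[pred r | U (piece_of (act b (s r) y))]| = (\sum_(n | U n) M n)%N.
  by rewrite -sum_mult_pred.
have MU' : #|[pred r | U (piece_of (act b (s r * gs l)%g y))]| = (\sum_(n | U n) M' n)%N.
  rewrite -sum_mult_pred; apply: eq_bigr => n _; rewrite /M'; congr (mult _ n).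
  by apply/ffunP => r; rewrite !ffunE actM.
have := reiter_s l (fun h => U (piece_of (act b h y))).
rewrite MU MU' -lerBlDl; apply: le_trans.
rewrite !natr_sum -sumrB [leRHS]big_mkcond; apply: ler_sum => n _.
by rewrite /U; case: ltnP; rewrite ?subrr.
Qed.

(** Positions are grouped by piece. A piece not visited by [gs l y] is charged to the Reiter error,
    as [theta <= 1]; on the others [M A <= min A + (M - min)], as [A <= 1]. *)
Lemma sum_theta_le i j l y : discerned l y ->
  \sum_r theta i j l r (stat y r).2 <=
    \sum_n (minn (mult (stat y) n) (mult (stat (act b (gs l) y)) n))%:R *
      agreement cond_pr paint_of (stat y) (stat (act b (gs l) y)) i j n + e * q%:R.
Proof.
move=> gy; apply: (le_trans _ (lerD (lexx _) (mult_reiter l y))).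
rewrite (partition_big (stat y) xpredT)//= -big_split/=; apply: ler_sum => n _.
set M := mult (stat y) n; set M' := mult _ n; set A := agreement _ _ _ _ _ _ _.
have sumC (c : R) : \sum_(r < q | stat y r == n) c = M%:R * c.
  by rewrite sumr_const mulr_natl.
have A1 : A <= 1 by apply: agreement_le1; [exact: cond_pr_ge0|exact: sum_cond_pr].
have minM : (minn M M')%:R <= M%:R :> R by rewrite ler_nat geq_minl.
have [M'0|M'0] := posnP M'.
  rewrite M'0 minn0 mul0r add0r subr0 -[leRHS]mulr1 -sumC.
  by apply: ler_sum => r _; exact: theta_le1.
apply: (@le_trans _ _ (M%:R * A)).
  rewrite -sumC; apply: ler_sum => r /eqP rn; rewrite rn.
  exact: theta_le_agreement.
nra.
Qed.

Definition confused_set l : set b :=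
  \bigcup_(p : 'I_q * 'I_q) confused E (s p.1) (s p.2 * gs l)%g res.

Lemma measurable_confused_set l : measurable (confused_set l).
Proof.
apply: fin_bigcup_measurable => [|p _]; first exact: finite_finset.
exact: measurable_confused.
Qed.

Lemma discerned_setC l y : ~ confused_set l y -> discerned l y.
Proof.
move=> ny r r' [E1 _]; apply: contrapT => ne.
by apply: ny; exists (r, r').
Qed.

Let verdict_of := joint_verdict (N := piece) paint_of.
Let weight := proposal_weight (q := q) cond_pr.

Definition target i j l : R :=
  pr (meas a) [set x | colour x = i /\ colour (act a (gs l) x) = j].

Lemma measurable_target i j l :
  measurable [set x | colour x = i /\ colour (act a (gs l) x) = j].
Proof. by apply: measurableI; [exact: mcolour|exact: fin_measurable_act]. Qed.

(* The only use of the equality of types. *)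
Lemma mean_theta i j l :
  \sum_p pr (meas b) [set y | stat2 l y = p] *
    ((\sum_r theta i j l r (p.1 r).2) / q%:R) = target i j l.
Proof.
under eq_bigr do rewrite mulrA mulr_sumr.
rewrite -mulr_suml exchange_big/=.
under eq_bigr => r _ do rewrite (@sum_pr_comp _ _ _ _ _ _ (stat2 l)
  (fun p => (p.1 r).2) (theta i j l r) (@fin_measurable_stat2 l)).
have patE r tau : pr (meas b) [set y | ((stat2 l y).1 r).2 = tau] = pattern_pr tau.
  rewrite /pattern_pr ab -[RHS](pr_act (s r)); last exact: fin_measurable_fix_pattern.
  by congr (pr _ _); apply/seteqP; split=> y; rewrite /= /stat ffunE.
under eq_bigr => r _ do under eq_bigr do rewrite patE theta_mulr.
(* Summation over patterns undoes the conditioning, and invariance under [s r] removes the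
   dependence on the position [r]. *)
have targetE r : \sum_tau pr (meas a)
  [set x | [/\ colour (act a (s r)^-1%g x) = i,
     colour (act a (gs l * (s r)^-1)%g x) = j & fix_pattern word x = tau]] = target i j l.
  rewrite /target -[RHS](pr_act (s r)^-1%g); last exact: measurable_target.
  rewrite (pr_partition _ (@fin_measurable_fix_pattern _ _ a _ word)).
    apply: eq_bigr => tau _; congr (pr _ _); apply/seteqP; split=> x.
      by move=> [xi xj xt]; split=> //; split=> //=; rewrite -actM.
    by move=> [[xi xj] xt]; split=> //; rewrite actM.
  exact/measurable_preimage_act/measurable_target.
under eq_bigr do rewrite targetE.
by rewrite sumr_const card_ord -[X in X / _]mulr_natr mulfK// pnatr_eq0 -lt0n.
Qed.

Let slack T := failure R piece T + 2 * e.

(** A statistic realised by a discerned point succeeds up to [slack]; the fibre of any other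
    statistic lies in [confused_set l], whose measure is the last loss. *)
Lemma mean_success_ge i j l T : inhabited piece ->
  target i j l - slack T - pr (meas b) (confused_set l) <=
  mean_success weight (fun p => pr (meas b) [set y | stat2 l y = p])
    (fun p => verdict_of p i j) T.
Proof.
move=> [n0]; rewrite -mean_theta lerBlDr lerBlDr /mean_success.
have mbad := measurable_confused_set l.
rewrite (pr_partition _ (fin_measurable_stat2 l) mbad).
have -> : slack T = \sum_p pr (meas b) [set y | stat2 l y = p] * slack T.
  by rewrite -mulr_suml sum_pr_fin ?mul1r//; exact: fin_measurable_stat2.
rewrite -!big_split/=; apply: ler_sum => p _.
set Lp := pr _ [set y | stat2 l y = p]; set u := success_by _ _ _; set H := _ / _.
have Lp0 : 0 <= Lp by exact: pr_ge0.
have u0 : 0 <= u by apply: success_by_ge0 => z; apply: proposal_weight_ge0 => //; exact: cond_pr_ge0.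
have sl0 : 0 <= slack T.
  rewrite addr_ge0 ?mulr_ge0// exprn_ge0// subr_ge0 invf_le1 ?ltr0n ?ler1n ?(cardN_gt0 n0)//.
have H1 : H <= 1.
  rewrite ler_pdivrMr ?ltr0n// mul1r -[X in X%:R]card_ord -sumr_const.
  by apply: ler_sum => r _; exact: theta_le1.
have [[y [yp gy]]|ny] := pselect (exists y, stat2 l y = p /\ discerned l y).
  have Hu : H <= u + slack T.
    rewrite /slack addrA /H /u -yp; apply: (proposals_succeed n0) => //.
    - exact: cond_pr_ge0.
    - exact: sum_cond_pr.
    - exact: mult_reiter.
    - exact: sum_theta_le.
  have := ler_wpM2l Lp0 Hu.
  have : 0 <= pr (meas b) (confused_set l `&` [set y | stat2 l y = p]) by exact: pr_ge0.
  rewrite mulrDr; lra.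
have Lle : Lp <= pr (meas b) (confused_set l `&` [set y | stat2 l y = p]).
  apply: pr_le; [exact: fin_measurable_stat2|by apply: measurableI => //; exact: fin_measurable_stat2|].
  move=> y yp; split=> //; apply: contrapT => /discerned_setC gy.
  by apply: ny; exists y.
have := ler_wpM2l Lp0 H1; have := mulr_ge0 Lp0 u0; have := mulr_ge0 Lp0 sl0; lra.
Qed.

Definition piece_mass := \sum_c pr (meas b) [set y | itinerary E res y = c] ^+ 2.

Lemma sum_piece_sq_le : \sum_n pr (meas b) [set y | piece_of y = n] ^+ 2 <= piece_mass.
Proof.
have -> : \sum_n pr (meas b) [set y | piece_of y = n] ^+ 2 =
    \sum_c \sum_tau pr (meas b) [set y | piece_of y = (c, tau)] ^+ 2.
  by rewrite pair_bigA; apply: eq_bigr => -[].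
apply: ler_sum => c _; rewrite expr2.
have mc : measurable [set y | itinerary E res y = c] by exact: fin_measurable_itinerary.
have piece_le tau : pr (meas b) [set y | piece_of y = (c, tau)] <=
    pr (meas b) [set y | itinerary E res y = c].
  by apply: pr_le => //; [exact: fin_measurable_piece_of|move=> y [yc _]].
rewrite {1}(pr_partition (meas b) (@fin_measurable_fix_pattern _ _ b _ word) mc).
rewrite mulr_suml; apply: ler_sum => tau _; rewrite expr2.
rewrite (_ : _ `&` _ = [set y | piece_of y = (c, tau)]); last first.
  apply/seteqP; split=> y; first by move=> [/= yc yt]; rewrite /= /piece_of yc yt.
  by move=> /= [yc yt].
by rewrite ler_wpM2l ?pr_ge0.
Qed.

(** Overlapping statistics share a piece, so one of the [2 q] entries of [p] equals one of the [2 q]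
    entries of [p']. By invariance each entry is distributed as [piece_of]; for independent [p] and
    [p'], each of the [(2 q)^2] coincidences thus has probability at most [piece_mass]. *)
Lemma overlap_mass_le l i j :
  \sum_p \sum_p' pr (meas b) [set y | stat2 l y = p] * pr (meas b) [set y | stat2 l y = p'] *
     (overlap (fun p => verdict_of p i j) p p')%:R <= (q * 2)%:R ^+ 2 * piece_mass.
Proof.
pose entry (c : 'I_q * bool) (p : {ffun 'I_q -> piece} * {ffun 'I_q -> piece}) :=
  if c.2 then p.1 c.1 else p.2 c.1.
pose L p := pr (meas b) [set y | stat2 l y = p].
have hit p z : verdict_of p i j z != None -> exists c, entry c p = z.1.1.
  rewrite joint_verdict_eq_None -ltnNge => /(leq_ltn_trans (leq0n _)).
  rewrite leq_max !mult_gt0 => /orP[/existsP[r /eqP rz]|/existsP[r /eqP rz]].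
    by exists (r, true).
  by exists (r, false).
have ov p p' : (overlap (fun p => verdict_of p i j) p p')%:R <=
    \sum_c \sum_c' (entry c p == entry c' p')%:R :> R.
  case: (boolP (overlap _ p p')) => [/existsP[z /andP[/hit[c cz] /hit[c' cz']]]|_]; last first.
    by apply: sumr_ge0 => c _; apply: sumr_ge0 => c' _.
  rewrite (bigD1 c)//= (bigD1 c')//= cz cz' eqxx -addrA lerDl addr_ge0 ?sumr_ge0//.
  by move=> c1 _; apply: sumr_ge0.
apply: (@le_trans _ _ (\sum_p \sum_p' L p * L p' * \sum_c \sum_c' (entry c p == entry c' p')%:R)).
  by do 2 (apply: ler_sum => ? _); rewrite ler_wpM2l ?mulr_ge0 ?pr_ge0.
have entry_pr c n : pr (meas b) [set y | entry c (stat2 l y) = n] = pr (meas b) [set y | piece_of y = n].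
  pose g := if c.2 then s c.1 else (s c.1 * gs l)%g.
  rewrite -[RHS](pr_act g); last exact: fin_measurable_piece_of.
  congr (pr _ _); apply/seteqP; split=> y; rewrite /= /entry /stat2 /stat /g;
  by case: c.2 => /=; rewrite ffunE ?actM.
have mst := fin_measurable_stat2 l.
have pairE c c' : \sum_p \sum_p' L p * L p' * (entry c p == entry c' p')%:R =
    \sum_n pr (meas b) [set y | piece_of y = n] ^+ 2.
  transitivity (\sum_p L p * pr (meas b) [set y | piece_of y = entry c p]).
    apply: eq_bigr => p _.
    under eq_bigr do rewrite -mulrA.
    rewrite -mulr_sumr; congr (_ * _).
    rewrite (@sum_pr_comp _ _ _ _ _ _ (stat2 l) (entry c') (fun n => (entry c p == n)%:R) mst).
    rewrite (bigD1 (entry c p))//= eqxx mulr1 entry_pr big1 ?addr0// => n np.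
    by rewrite eq_sym (negbTE np) mulr0.
  rewrite (@sum_pr_comp _ _ _ _ _ _ (stat2 l) (entry c)
    (fun n => pr (meas b) [set y | piece_of y = n]) mst).
  by apply: eq_bigr => n _; rewrite entry_pr expr2.
have -> : \sum_p \sum_p' L p * L p' * \sum_c \sum_c' (entry c p == entry c' p')%:R =
    \sum_c \sum_c' \sum_p \sum_p' L p * L p' * (entry c p == entry c' p')%:R.
  under eq_bigr do under eq_bigr do rewrite mulr_sumr.
  under eq_bigr do rewrite exchange_big/=.
  rewrite exchange_big/=; apply: eq_bigr => c _.
  under eq_bigr do under eq_bigr do rewrite mulr_sumr.
  under eq_bigr do rewrite exchange_big/=.
  by rewrite exchange_big/=.
under eq_bigr do under eq_bigr do rewrite pairE.
rewrite !sumr_const !card_prod card_bool card_ord -mulrnA -[leLHS]mulr_natl natrM -expr2.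
by rewrite ler_wpM2l ?sqr_ge0// sum_piece_sq_le.
Qed.

Variable d0 : 'I_k.

Definition transferred T (w : trials (piece * 'I_q * sample)%type T) (y : b) : 'I_k :=
  first_accepted d0 (verdict paint_of (stat y)) w.

Lemma fin_measurable_transferred T w : fin_measurable (@transferred T w).
Proof.
exact: (fin_measurable_comp (fun t => first_accepted d0 (verdict paint_of t) w)
  fin_measurable_stat).
Qed.

(** Joint success is one way of obtaining the colours [i] and [j], which may also come from
    different centres: hence only a lower bound. *)
Lemma success_mass_le i j l T w :
  success_mass (fun p => pr (meas b) [set y | stat2 l y = p]) (fun p => verdict_of p i j) w <=
  pr (meas b) [set y | @transferred T w y = i /\ transferred w (act b (gs l) y) = j].
Proof.
pose Q (p : {ffun 'I_q -> piece} * {ffun 'I_q -> piece}) :=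
  (first_accepted d0 (verdict paint_of p.1) w == i) && (first_accepted d0 (verdict paint_of p.2) w == j).
have := pr_fin_pred (meas b) Q (fin_measurable_stat2 l).
rewrite (_ : [set x | _] = [set y | @transferred T w y = i /\ transferred w (act b (gs l) y) = j]).
  move=> ->; rewrite [leRHS]big_mkcond; apply: ler_sum => p _.
  case: (boolP (first_accepted _ _ w)) => [/first_joint_verdict - /(_ d0)[E1 E2]|_].
    by rewrite /Q E1 E2 !eqxx mulr1.
  by rewrite mulr0; case: ifP => // _; exact: pr_ge0.
by apply/seteqP; split=> y /=; [move=> /andP[/eqP ? /eqP]|move=> [yi yj]; apply/andP; split; apply/eqP].
Qed.

End Transfer.

(** * Choice of the parameters *)

Lemma near_finite (I : finType) (Q : I -> nat -> Prop) :
  (forall i, \forall n \near \oo, Q i n) -> \forall n \near \oo, forall i, Q i n.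
Proof.
move=> nQ.
have nQ' i : exists N, forall n, (N <= n)%N -> Q i n.
  by have [N _ QN] := nQ i; exists N.
pose N i := sval (cid (nQ' i)).
exists (\max_i N i)%N => // n /= Nn i.
by apply: (svalP (cid (nQ' i))); exact: leq_trans (leq_bigmax i) Nn.
Qed.

Lemma exists_small_failure (R : realType) (N : finType) (e : R) :
  N -> 0 < e -> exists T, failure R N T < e.
Proof.
move=> n0 e0; have N0 := cardN_gt0 n0.
have z1 : `|1 - #|N|%:R^-1| < 1 :> R.
  rewrite ger0_norm; first by rewrite ltrBlDr ltrDl invr_gt0 ltr0n.
  by rewrite subr_ge0 invf_le1 ?ltr0n// ler1n.
have /cvgrPdist_lt /(_ e e0) := cvg_expr z1.
move=> /filter_ex[T]; rewrite sub0r normrN => Te; exists T.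
exact: le_lt_trans (ler_norm _) Te.
Qed.

Lemma failure01 (R : realType) (N : finType) T : N -> 0 <= failure R N T <= 1.
Proof.
move=> n0; have N0 := cardN_gt0 n0.
have N1 : #|N|%:R^-1 <= 1 :> R by rewrite invf_le1 ?ltr0n// ler1n.
by rewrite exprn_ge0 ?subr_ge0//= exprn_ile1 ?subr_ge0// lerBlDr lerDl.
Qed.

Lemma random_transfer (R : realType) (Gamma : countGroupType) (a b : pmp_action R Gamma)
    (k : nat) (colour : a -> 'I_k) (m : nat) (gs : 'I_m -> Gamma) (eps : R) (d0 : 'I_k) :
  amenable R Gamma -> same_patterns a b -> fin_measurable colour -> 0 < eps ->
  exists (Om : finType) (wt : Om -> R) (col : Om -> b -> 'I_k),
  [/\ forall w, 0 <= wt w, \sum_w wt w = 1, forall w, fin_measurable (col w),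
    forall i j l, target colour gs i j l - eps <=
      \sum_w wt w * pr (meas b) [set y | col w y = i /\ col w (act b (gs l) y) = j]
  & (forall y : b, meas b [set y] = 0%E) -> exists w, forall i j l,
      target colour gs i j l - eps <=
      pr (meas b) [set y | col w y = i /\ col w (act b (gs l) y) = j]].
Proof.
(* The losses are [2 e] from Reiter's condition, [e] from truncation, [e] from confused points and
   [e] from concentration. *)
move=> am ab mc eps0; pose e := eps / 8.
have e0 : 0 < e by rewrite divr_gt0.
have [q [st [q0 reit]]] := reiter gs am e0.
pose s r := tnth st r.
have reit_s l (B : pred Gamma) :
    #|[pred r | B (s r)]|%:R <= #|[pred r | B (s r * gs l)%g]|%:R + e * q%:R :> R.
  have countE (P : pred Gamma) : count P st = #|[pred r | P (s r)]|.
    by rewrite -sum1_count big_tuple sum1_card.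
  by have := reit l B; rewrite !countE.
have [E [mE sepE]] := standard_borel_separated (standard_space b).
pose K : finType := ('I_k * 'I_k * 'I_m)%type.
(* The variance is at most [3 c0] from truncation plus [c0] from overlaps, and
   [#|K| * (4 c0) < e ^+ 2] as [exists_concentrated] requires. *)
pose c0 := e ^+ 2 / (8 * (#|K|%:R + 1)).
have K0 : 0 < #|K|%:R + 1 :> R by rewrite ltr_wpDl.
have c00 : 0 < c0 by rewrite divr_gt0 ?exprn_gt0// mulr_gt0.
have q20 : 0 < (q * 2)%:R ^+ 2 :> R by rewrite exprn_gt0// ltr0n muln_gt0 q0.
have near_conf : \forall n \near \oo, forall l, pr (meas b) (confused_set gs s E n l) <= e.
  pose J : finType := ('I_m * ('I_q * 'I_q))%type.
  have eJ0 : 0 < e / (q * q)%:R by rewrite divr_gt0// ltr0n muln_gt0 q0.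
  have := @near_finite J _ (fun p => near_not_confused mE sepE (s p.2.1) (s p.2.2 * gs p.1)%g eJ0).
  apply: filterS => n small l.
  apply: (le_trans (pr_bigcup_le _ _)); first by move=> p; exact: measurable_confused.
  apply: (@le_trans _ _ (\sum_(p : 'I_q * 'I_q) e / (q * q)%:R)).
    by apply: ler_sum => p _; apply: ltW; exact: (small (l, p)).
  by rewrite sumr_const card_prod card_ord -[X in X <= _]mulr_natr divfK// gt_eqF// ltr0n muln_gt0 q0.
have near_piece : (forall y : b, meas b [set y] = 0%E) ->
    \forall n \near \oo, (q * 2)%:R ^+ 2 * piece_mass E n <= c0.
  move=> at0; have := near_small_pieces mE sepE at0 (divr_gt0 c00 q20).
  by apply: filterS => n; rewrite ltr_pdivlMr// mulrC => /ltW.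
(* A single resolution serves both conclusions, although small pieces are available only in the
   absence of atoms. *)
have [n [nconf npiece]] : exists n,
    (forall l, pr (meas b) (confused_set gs s E n l) <= e) /\
    ((forall y : b, meas b [set y] = 0%E) -> (q * 2)%:R ^+ 2 * piece_mass E n <= c0).
  have [at0|nat0] := pselect (forall y : b, meas b [set y] = 0%E).
    have near_both : \forall n \near \oo,
        (forall l, pr (meas b) (confused_set gs s E n l) <= e) /\
        (q * 2)%:R ^+ 2 * piece_mass E n <= c0.
      by apply: filterI; [exact: near_conf|exact: near_piece].
    by have /filter_ex[n [h1 h2]] := near_both; exists n.
  by have /filter_ex[n h1] := near_conf; exists n.
pose piece : finType := ({ffun 'I_n -> bool} * {ffun 'I_q * 'I_q * 'I_m -> bool})%type.
pose n0 : piece := ([ffun=> false], [ffun=> false]).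
(* [T] comes last, since the rate of acceptance depends on the number of pieces and so on the
   resolution. The bound [e] serves the mean, [c0] the variance. *)
have [T Tc] : exists T, failure R piece T < Num.min e c0.
  by apply: exists_small_failure => //; rewrite lt_min e0.
move: Tc; rewrite lt_min => /andP[Te Tc].
pose W := proposal_weight (q := q) (cond_pr colour gs s (res:=n)).
have W0 z : 0 <= W z by apply: proposal_weight_ge0 => // *; exact: cond_pr_ge0.
have W1 : \sum_z W z = 1.
  by apply: proposal_weight1 => // *; exact: sum_cond_pr.
pose Lm l p := pr (meas b) [set y | stat2 gs s E n l y = p].
pose ev i j (p : {ffun 'I_q -> piece} * {ffun 'I_q -> piece}) :=
  joint_verdict (@paint_of k m q) p i j.
have mean_ge i j l : target colour gs i j l - 4 * e <= mean_success W (Lm l) (ev i j) T.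
  have := mean_success_ge ab mc q0 (ltW e0) reit_s mE i j l T (inhabits n0).
  by apply: le_trans; have := nconf l; move: Te => /=; lra.
pose sample : finType := ({ffun 'I_q -> 'I_k} * {ffun 'I_q * 'I_q * 'I_m -> bool})%type.
pose Om := trials (piece * 'I_q * sample)%type T.
have massE i j l (w : Om) := success_mass_le gs s mE d0 i j l w.
exists Om, (@trials_weight R _ W T), (transferred gs s E d0 (T:=T)).
split.
- by move=> w; exact: trials_weight_ge0.
- exact: sum_trials_weight.
- by move=> w; exact: fin_measurable_transferred.
- move=> i j l; apply: (@le_trans _ _ (mean_success W (Lm l) (ev i j) T)).
    by apply: le_trans (mean_ge i j l); rewrite /e; lra.
  rewrite -expect_success_mass; apply: ler_sum => w _.
  by rewrite ler_wpM2l ?trials_weight_ge0//; exact: massE.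
move=> at0.
pose mean (p : K) := mean_success W (Lm p.2) (ev p.1.1 p.1.2) T.
pose mass (p : K) (w : Om) := success_mass (Lm p.2) (ev p.1.1 p.1.2) w.
have [w fw] : exists w, forall p, mean p - e <= mass p w.
  apply: (@exists_concentrated _ _ W T K mass mean (4 * c0)) => //.
    move=> p; apply: le_trans.
      apply: (@variance_le _ _ W W0 W1 _ (Lm p.2) _ _ (ev p.1.1 p.1.2) T (failure R piece T)).
      - by move=> ?; exact: pr_ge0.
      - exact/sum_pr_fin/fin_measurable_stat2.
      - exact: failure01.
      - move=> p'; have invN0 : 0 < #|piece|%:R^-1 :> R by rewrite invr_gt0 ltr0n (cardN_gt0 n0).
        apply: (lt_le_trans invN0); apply: (accept_joint_ge n0) => // *.
        exact: sum_cond_pr.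
      - move=> p'; apply: success_by_joint_ge => // *; [exact: cond_pr_ge0|exact: sum_cond_pr].
    have := overlap_mass_le gs s n mE p.2 p.1.1 p.1.2.
    have := npiece at0; move: Tc; rewrite -/piece -/(Lm _) /=; lra.
  have -> : 4 * c0 = e ^+ 2 / (2 * (#|K|%:R + 1)) by rewrite /c0; field; rewrite gt_eqF.
  rewrite mulrA ltr_pdivrMr ?mulr_gt0// mulrC ltr_pM2l ?exprn_gt0//.
  have : 0 <= #|K|%:R :> R by []; lra.
exists w => i j l; apply: le_trans (massE i j l w).
apply: le_trans (fw (i, j, l)) => /=.
have := mean_ge i j l; rewrite /mean /e /=; move: (mean_success _ _ _ _) => M; lra.
Qed.

(** * Types and moved points *)

Section TypeBasics.
Variable Gamma : countGroupType.

Lemma open_cylinder (g : Gamma) (c : bool) : open [set H : Defs.Sub Gamma | val H g = c].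
Proof.
exists [set f : {ptws Gamma -> bool} | f g = c] => //.
have cg : continuous (fun f : {ptws Gamma -> bool} => f g) by exact: proj_continuous.
by apply: (open_comp (f := fun f : {ptws Gamma -> bool} => f g) (D := [set c]));
  [move=> f _; exact: cg|exact: discrete_open].
Qed.

Lemma measurable_cylinder (g : Gamma) (c : bool) :
  measurable ([set H | val H g = c] : set (BorelSub Gamma)).
Proof. by apply: sub_gen_smallest; exact: open_cylinder. Qed.

Definition left_coset (H : BorelSub Gamma) (g : Gamma) : set Gamma :=
  [set (g * h)%g | h in [set h | val H h]].

Lemma left_cosetE (H : BorelSub Gamma) g g' :
  left_coset H g = left_coset H g' <-> val H (g^-1 * g')%g.
Proof.
have [one div] : group_closed (val H : {pred Gamma}) by have := set_valP H.
have inv h : val H h -> val H h^-1%g by move=> Hh; rewrite -[h^-1%g]mul1g; exact: div.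
have mul h h' : val H h -> val H h' -> val H (h * h')%g.
  by move=> Hh Hh'; rewrite -[h']invgK; apply: div => //; exact: inv.
split=> [E|Hg].
  have : left_coset H g' g' by exists 1%g; rewrite ?mulg1//; exact: one.
  by rewrite -E => -[h /= Hh <-]; rewrite mulgA mulVg mul1g.
apply/seteqP; split=> x [h /= Hh <-].
  exists (g'^-1 * g * h)%g; last by rewrite !mulgA mulgV mul1g.
  by apply: mul => //; rewrite -[(g'^-1 * g)%g]invgK invgM invgK inv.
exists (g^-1 * g' * h)%g; last by rewrite !mulgA mulgV mul1g.
exact: mul.
Qed.

Lemma infinite_indexP (H : BorelSub Gamma) : infinite_index H <->
  ~ exists s : seq Gamma, forall g, exists2 h, h \in s & val H (h^-1 * g)%g.
Proof.
apply: not_iff_compat; split=> [/finite_seqP[s sE]|[s sH]].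
  exists [seq xget 1%g [set g | left_coset H g = C] | C <- s] => g.
  have gs : left_coset H g \in s.
    by have : [set` s] (left_coset H g) by rewrite -sE; exists g.
  exists (xget 1%g [set h | left_coset H h = left_coset H g]); first exact: map_f.
  by apply/left_cosetE; apply: (@xgetPex _ 1%g [set h | left_coset H h = _]); exists g.
apply: (@sub_finite_set _ _ [set` [seq left_coset H h | h <- s]]) => //.
move=> _ [g _ <-] /=; have [h hs /left_cosetE hg] := sH g.
by apply/mapP; exists h.
Qed.

(** Finite sequences in [Gamma] are countably many, so finite index, in the form of
    [infinite_indexP], is a countable combination of cylinders. *)
Lemma measurable_infinite_index : measurable (@infinite_index Gamma).
Proof.
rewrite (_ : @infinite_index Gamma = ~` \bigcup_(s : seq Gamma)
   \bigcap_(g : Gamma) \bigcup_(h in [set` s]) [set H | val H (h^-1 * g)%g = true]).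
  apply: measurableC; rewrite -[X in measurable X]setCK setC_bigcup.
  apply/measurableC/countable_bigcap_measurable; first exact: countableP.
  move=> s; apply: measurableC; apply: countable_bigcap_measurable; first exact: countableP.
  by move=> g; apply: fin_bigcup_measurable => // h _; exact: measurable_cylinder.
apply/seteqP; split=> H.
  move=> /infinite_indexP Hinf [s _ sH]; apply: Hinf; exists s => g.
  by have [h /= hs Hh] := sH g I; exists h.
move=> nH; apply/infinite_indexP => -[s sH]; apply: nH; exists s => // g _.
by have [h hs Hh] := sH g; exists h.
Qed.

(** Complements of avoidance events for one element give membership events, hence all cylinders. The
    generators are closed under intersection and their preimages under [stab] are the sets
    [moved_points], which stable weak containment controls. *)
Lemma cylinders_generate : measurable =
  <<s [set S : set (BorelSub Gamma) | exists F : seq Gamma,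
         S = [set H | forall g, g \in F -> val H g = false]] >>.
Proof.
set G := [set S | _].
have mG (p : seq (Gamma * bool)) :
    <<s G >> [set H : BorelSub Gamma | forall c, c \in p -> val H c.1 = c.2].
  have mc g (c : bool) : <<s G >> [set H : BorelSub Gamma | val H g = c].
    have mf : <<s G >> [set H : BorelSub Gamma | val H g = false].
      apply: sub_gen_smallest; exists [:: g]; apply/seteqP; split=> H /=.
        by move=> Hg g'; rewrite inE => /eqP ->.
      by apply; rewrite mem_head.
    case: c => //.
    rewrite (_ : [set H | _] = ~` [set H | val H g = false]).
      exact: (@measurableC _ (g_sigma_algebraType G)).
    by apply/seteqP; split=> H /=; [move=> ->|case: (val H g)].
  rewrite (_ : [set H | _] = \bigcap_(c in [set` p]) [set H | val H c.1 = c.2]); last by [].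
  apply: (@countable_bigcap_measurable _ (g_sigma_algebraType G)); first exact: countableP.
  by move=> [g c]; exact: mc.
rewrite eqEsubset; split; last first.
  apply: smallest_sub; first exact: sigma_algebra_measurable.
  move=> _ [F ->].
  rewrite (_ : [set H | _] = \bigcap_(g in [set` F]) [set H | val H g = false]); last by [].
  apply: countable_bigcap_measurable; first exact: countableP.
  by move=> g; exact: measurable_cylinder.
apply: smallest_sub; first exact: (@sigma_algebra_measurable _ (g_sigma_algebraType G)).
move=> U oU; pose C (p : seq (Gamma * bool)) :=
  [set H : BorelSub Gamma | forall c, c \in p -> val H c.1 = c.2].
rewrite (_ : U = \bigcup_(p in [set p | C p `<=` U]) C p).
  rewrite -[X in _ X]setCK setC_bigcup; apply: (@measurableC _ (g_sigma_algebraType G)).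
  apply: (@countable_bigcap_measurable _ (g_sigma_algebraType G)); first exact: countableP.
  by move=> p; apply: (@measurableC _ (g_sigma_algebraType G)); exact: mG.
apply/seteqP; split=> [H UH|H [p pU]]; last exact: pU.
have [s sU] := Sub_basis oU UH.
exists [seq (g, val H g) | g <- s]; last by move=> c /mapP[g gs ->].
by move=> K CK; apply: sU => g gs; apply: (CK (g, _)); apply/mapP; exists g.
Qed.

End TypeBasics.

Section TypeActions.
Context (R : realType) (Gamma : countGroupType).
Implicit Types a b : pmp_action R Gamma.

Lemma same_type_patterns a b : same_type a b -> same_patterns a b.
Proof.
move=> ab J h tau.
pose S : set (BorelSub Gamma) := \bigcap_(i : J) [set H | val H (h i) = tau i].
have mS : measurable S.
  apply: countable_bigcap_measurable; first exact: countableP.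
  by move=> i; exact: measurable_cylinder.
have stabE (c : pmp_action R Gamma) : [set x : c | fix_pattern h x = tau] = @stab R Gamma c @^-1` S.
  apply/seteqP; split=> x /=; first by move=> xt i _; rewrite /= -xt ffunE.
  by move=> xS; apply/ffunP => i; rewrite ffunE; exact: xS i I.
by rewrite /pr !stabE; congr fine; exact: ab.
Qed.

(** An atom must have a stabiliser of infinite index, since the points of finite index form a null
    set. Its orbit is then infinite, with the same mass at every point, so that finitely many points
    exceed total mass 1. *)
Lemma infinite_index_atomless a (y : a) :
  action_type a (@infinite_index Gamma) = 1%E -> meas a [set y] = 0%E.
Proof.
move=> inf1.
have [E [mE sepE]] := standard_borel_separated (standard_space a).
have m1 (x : a) : measurable [set x] by exact: (measurable_singleton mE sepE).
pose p := pr (meas a) [set y].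
have [p0|p0] := eqVneq p 0; first by rewrite prE// -/p p0.
have {}p0 : 0 < p by rewrite lt_neqAle eq_sym p0 pr_ge0.
have yinf : infinite_index (stab y).
  apply: contrapT => yfin.
  have mI : measurable (@stab R Gamma a @^-1` @infinite_index Gamma).
    by rewrite -[X in measurable X]setTI; exact: (@measurable_stab R Gamma a measurableT _ (@measurable_infinite_index Gamma)).
  have := pr_le (meas a) (m1 y) (measurableC mI); rewrite -/p pr_setC// => le0.
  have E1 : pr (meas a) (@stab R Gamma a @^-1` @infinite_index Gamma) = 1.
    by rewrite /pr -[X in fine X]/(action_type a (@infinite_index Gamma)) inf1.
  by move: (le0 (fun x xy => ltac:(rewrite xy; exact: yfin))); rewrite E1; lra.
have orbit n : exists s : seq Gamma, size s = n /\ uniq [seq act a g y | g <- s].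
  elim: n => [|n [s [sn su]]]; first by exists [::].
  have /infinite_indexP/forallNP/(_ s)/existsNP[g sg] := yinf.
  exists (g :: s); rewrite /= sn su andbT; split=> //.
  apply/negP => /mapP[h hs gh]; apply: sg; exists h => //.
  by apply/eqP; exact/act_eqE.
have mseq (l : seq a) : measurable [set` l].
  rewrite (_ : [set` l] = \bigcup_(x in [set` l]) [set x]).
    exact: fin_bigcup_measurable.
  by apply/seteqP; split=> [x xl|x [x' x'l ->]//]; exists x.
have sum_orbit (s : seq Gamma) : uniq [seq act a g y | g <- s] ->
    pr (meas a) [set` [seq act a g y | g <- s]] = (size s)%:R * p.
  elim: s => [_|g s IH /= /andP[gs su]].
    rewrite mul0r (_ : [set` _] = set0) ?pr_set0//.
    by apply/seteqP; split.
  rewrite (_ : [set` _] = [set act a g y] `|` [set` [seq act a g y | g <- s]]).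
    rewrite prU ?IH//; last first.
      by apply/seteqP; split=> // x [/= ->]; rewrite (negbTE gs).
    rewrite -natr1 mulrDl mul1r addrC; congr (_ + _).
    rewrite /p -[RHS](pr_act g^-1%g)//; congr (pr _ _); apply/seteqP; split=> x /=.
      by move=> ->; rewrite actK.
    by move=> <-; rewrite actVK.
  apply/seteqP; split=> x /=; first by rewrite in_cons => /orP[/eqP|]; [left|right].
  by move=> [->|xs]; rewrite in_cons ?eqxx ?xs ?orbT.
have [s [sn su]] := orbit (Num.trunc p^-1).+1.
have : pr (meas a) [set` [seq act a g y | g <- s]] <= 1 by exact: pr_le1.
rewrite sum_orbit// sn -ler_pdivlMr// mul1r leNgt truncnS_gt//.
Qed.

End TypeActions.

Lemma image_act (R : realType) (Gamma : countGroupType) (a : pmp_action R Gamma) g (A : set a) :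
  act a g @` A = act a g^-1%g @^-1` A.
Proof.
apply/seteqP; split=> [_ [x Ax <-]|x /= Ax]; first by rewrite /= actK.
by exists (act a g^-1%g x); rewrite ?actVK.
Qed.

Lemma measurable_sections d (Y : measurableType d) m (D : set ('I_m.+1 * Y)) :
  (forall l, measurable [set y | D (l, y)]) -> measurable D.
Proof.
move=> mD; rewrite (_ : D = \bigcup_l ([set l] `*` [set y | D (l, y)])).
  apply: fin_bigcup_measurable => [|l _]; first exact: finite_finset.
  exact: measurableX.
by apply/seteqP; split=> [[l y] Dly|[l y] [l' _ [/= -> Dly]]]//; exists l.
Qed.

Section EtaProduct.
Context d (Y : measurableType d) (R : realType) (P : probability Y R).
Variables (m : nat) (alpha : 'I_m.+1 -> {nonneg R}).

Lemma eta_productE (S : set ('I_m.+1 * Y)) : measurable S ->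
  (Defs.eta alpha \x P)%E S = (\sum_l (alpha l)%:num * pr P [set y | S (l, y)])%:E.
Proof.
move=> mS.
have secE l : xsection S l = [set y | S (l, y)].
  by rewrite xsectionE.
rewrite -[LHS]/(\int[Defs.eta alpha]_l (P \o xsection S) l)%E.
rewrite /Defs.eta ge0_integral_measure_sum//.
rewrite -sumEFin; apply: eq_bigr => l _.
rewrite ge0_integral_mscale//= integral_dirac// diracT mul1e inord_val secE.
by rewrite prE ?EFinM// -secE; exact: measurable_xsection.
Qed.

End EtaProduct.

Definition moved_points (R : realType) (Gamma : countGroupType) (c : pmp_action R Gamma)
    (F : seq Gamma) : set c :=
  [set x | forall g, g \in F -> act c g x <> x].

Section Moved.
Context (R : realType) (Gamma : countGroupType).
Implicit Types a b : pmp_action R Gamma.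

Lemma measurable_moved_points a F : measurable (@moved_points R Gamma a F).
Proof.
rewrite (_ : moved_points F = \bigcap_(g in [set` F]) ~` [set x | act a g x = x]).
  apply: countable_bigcap_measurable; first exact: countableP.
  by move=> g; exact/measurableC/measurable_fix.
by [].
Qed.

(* Partition the moved points of a into pieces A_i with g A_i disjoint from A_i
   for g in F: a point of B_i fixed by g lies in g B_i `&` B_i, which is small. *)
Lemma stably_weakly_contained_moved a b F : stably_weakly_contained a b ->
  pr (meas a) (@moved_points R Gamma a F) <= pr (meas b) (@moved_points R Gamma b F).
Proof.
move=> ab; apply/ler_addgt0Pr => eps eps0; pose e := eps / 2.
have e_gt0 : 0 < e by rewrite divr_gt0.
have [E [mE sepE]] := standard_borel_separated (standard_space a).
pose N := size F; pose fg (i : 'I_N) := tnth (in_tuple F) i.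
have [n nconf] : exists n, forall i : 'I_N,
    pr (meas a) (confused E (fg i) 1%g n) < e / (N.+1)%:R.
  have eN : 0 < e / N.+1%:R by rewrite divr_gt0.
  have /filter_ex[n nP] := near_finite (fun i => near_not_confused mE sepE (fg i) 1%g eN).
  by exists n.
(* On [V] every [g] in [F] changes the itinerary, so the part of an itinerary atom inside [V] is
   disjoint from its translates. *)
pose V := moved_points F `\` \bigcup_i confused E (fg i) 1%g n.
have mmov c := measurable_moved_points c F.
have mconf : measurable (\bigcup_i confused E (fg i) 1%g n).
  apply: fin_bigcup_measurable => [|i _]; first exact: finite_finset.
  exact: measurable_confused.
have mV : measurable V by apply: measurableD.
have Vge : pr (meas a) (@moved_points R Gamma a F) - e <= pr (meas a) V.
  rewrite lerBlDr; apply: (@le_trans _ _ (pr (meas a) (V `|` \bigcup_i confused E (fg i) 1%g n))).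
    apply: pr_le => //; first exact: measurableU.
    by move=> x xm; have [|] := pselect ((\bigcup_i confused E (fg i) 1%g n) x); [right|left].
  rewrite (le_trans (prU_le _ mV mconf))// lerD2l (le_trans (pr_bigcup_le _ _))//.
    by move=> i; exact: measurable_confused.
  apply: (@le_trans _ _ (\sum_(i < N) e / N.+1%:R)).
    by apply: ler_sum => i _; exact: ltW.
  rewrite sumr_const card_ord -[leLHS]mulr_natr mulrAC ler_pdivrMr ?ltr0n//.
  by rewrite ler_wpM2l ?(ltW e_gt0)// ler_nat.
pose lab x : option {ffun 'I_n -> bool} := if `[< V x >] then Some (itinerary E n x) else None.
have mlab : fin_measurable lab.
  have := fin_measurable_pair (fin_measurable_bool mV) (@fin_measurable_itinerary _ _ E n mE).
  exact: (fin_measurable_comp (fun p => if p.1 then Some p.2 else None)).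
pose S : finType := option {ffun 'I_n -> bool}.
pose A (i : 'I_#|S|) := [set x | lab x = enum_val i].
have pA : borel_partition A.
  split; first by move=> i; exact: mlab.
    by move=> i j _ _ [x []]; rewrite /A/= => -> /enum_val_inj.
  by apply/seteqP; split=> // x _; exists (enum_rank (lab x)) => //; rewrite /A/= enum_rankK.
(* One [dl] for the piece [i0] and one for each pair of a position in [F] and a label: [e] in
   total. *)
pose dl := e / (1 + (N * #|S|)%:R).
have dl0 : 0 < dl by rewrite divr_gt0// ltr_wpDr.
(* The identity is added in order to compare the measures of [A i0] and [B i0]. *)
have finF : finite_set [set` 1%g :: F] by [].
have [m [alpha [alpha1 [B [mB tB BT] corr]]]] := ab _ A _ dl pA finF dl0.
pose i0 : 'I_#|S| := enum_rank (None : S).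
pose sec (D : set ('I_m.+1 * b)) l := [set y | D (l, y)].
pose nu D := \sum_l (alpha l)%:num * pr (meas b) (sec D l).
pose act2 g (ly : 'I_m.+1 * b) := (ly.1, act b g ly.2).
have msec D l : measurable D -> measurable (sec D l).
  by move=> mD; have := measurable_xsection l mD; rewrite xsectionE.
have secE g i l : sec (act2 g @` B i) l = act b g^-1%g @^-1` sec (B i) l.
  apply/seteqP; split=> y /=; first by move=> [[l' y'] Bly [<- <-]]; rewrite /sec /= actK.
  by move=> Bly; exists (l, act b g^-1%g y) => //; rewrite /act2/= actVK.
have mact2 g i : measurable (act2 g @` B i).
  apply: measurable_sections => l; rewrite -[X in measurable X]/(sec _ l) secE.
  exact/measurable_preimage_act/msec.
have mBB g i j : measurable (act2 g @` B i `&` B j) by exact: measurableI.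
have corrE g i j : g \in 1%g :: F ->
    `|pr (meas a) (act a g @` A i `&` A j) - nu (act2 g @` B i `&` B j)| < dl.
  move=> gF; have := corr g gF i j.
  rewrite (eta_productE _ _ (mBB g i j)) prE; last first.
    apply: measurableI; last exact: mlab.
    by rewrite image_act; apply: measurable_preimage_act; exact: mlab.
  by rewrite -EFinB abse_EFin lte_fin.
have nuB0 : nu (B i0) <= 1 - pr (meas a) V + dl.
  have := corrE 1%g i0 i0 (mem_head _ _).
  rewrite (_ : act a 1%g @` A i0 = A i0); last first.
    by rewrite image_act invg1; apply/seteqP; split=> x /=; rewrite act1.
  rewrite (_ : act2 1%g @` B i0 = B i0); last first.
    apply/seteqP; split=> [_ [[l y] Bly <-]|[l y] Bly]; first by rewrite /act2 act1.
    by exists (l, y) => //; rewrite /act2 /= act1.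
  rewrite !setIid (_ : A i0 = ~` V) ?pr_setC//.
    by rewrite ltr_norml => /andP[+ _]; lra.
  apply/seteqP; split=> x; rewrite /A /i0 /= enum_rankK /lab; case: asboolP => //.
have nuBB (r : 'I_N) i : i != i0 -> nu (act2 (fg r) @` B i `&` B i) <= dl.
  move=> ii0; have gF : fg r \in F by rewrite /fg mem_tnth.
  have := corrE (fg r) i i (mem_behead (s := 1%g :: F) gF).
  rewrite (_ : act a (fg r) @` A i `&` A i = set0).
    by rewrite pr_set0 sub0r normrN => /ltW; apply: le_trans; exact: ler_norm.
  apply/seteqP; split=> // x [[z Az <-] Agz]; move: Az Agz; rewrite /A /lab /=.
  case: asboolP => [[zm zc] zi|_ zi]; last first.
    by move: ii0; rewrite /i0 zi enum_valK eqxx.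
  case: asboolP => [_ gzi|_ gzi]; last by move: gzi; rewrite -zi.
  apply: zc; exists r => //; split; last by rewrite act1; exact: zm.
  by rewrite act1; move: gzi; rewrite -zi => -[].
pose mvd := pr (meas b) (@moved_points R Gamma b F).
(* In the fibre over [l], a point outside [B i0] that is not moved is fixed by some [g] in [F], and
   then lies in both [g B_i] and [B_i] for its own label [i]. *)
have cover l : 1 <= pr (meas b) (sec (B i0) l) + mvd +
    \sum_(p : 'I_N * 'I_#|S|) (if p.2 != i0 then pr (meas b) (sec (act2 (fg p.1) @` B p.2 `&` B p.2) l) else 0).
  pose D (p : 'I_N * 'I_#|S|) := if p.2 != i0 then sec (act2 (fg p.1) @` B p.2 `&` B p.2) l else set0.
  have mD p : measurable (D p) by rewrite /D; case: ifP => // _; exact: msec.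
  have mUD : measurable (\bigcup_p D p).
    by apply: fin_bigcup_measurable => //; exact: finite_finset.
  have mB0 : measurable (sec (B i0) l) by exact: msec.
  rewrite -(pr_setT (meas b)).
  apply: (@le_trans _ _ (pr (meas b) (sec (B i0) l `|` @moved_points R Gamma b F `|` \bigcup_p D p))).
    apply: pr_le => //; first by apply: measurableU => //; exact: measurableU.
    move=> y _; have : (\bigcup_i B i) (l, y) by rewrite BT.
    move=> [i _ Bi]; have [ii0|ii0] := eqVneq i i0; first by left; left; rewrite /sec /= -ii0.
    have [ym|/existsNP[g /not_implyP[gF /contrapT gy]]] := pselect (moved_points F y).
      by left; right.
    have /(tnthP (in_tuple F))[r gr] := gF.
    right; exists (r, i) => //; rewrite /D /= ii0; split=> //.
    by exists (l, y); rewrite // /act2 /fg -gr /= gy.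
  rewrite (le_trans (prU_le _ _ _))//; first exact: measurableU.
  rewrite lerD ?prU_le// (le_trans (pr_bigcup_le _ _))//; apply: ler_sum => p _.
  by rewrite /D; case: ifP; rewrite ?pr_set0.
have : 1 <= nu (B i0) + mvd + (N * #|S|)%:R * dl.
  have al0 l : 0 <= (alpha l)%:num by [].
  have alM : \sum_l (alpha l)%:num * mvd = mvd by rewrite -mulr_suml alpha1 mul1r.
  rewrite -[leLHS]alpha1; under eq_bigr do rewrite -[_%:num]mulr1.
  apply: (le_trans (ler_sum _ (fun l _ => ler_wpM2l (al0 l) (cover l)))).
  under eq_bigr do rewrite !mulrDr.
  rewrite !big_split/= alM lerD2l.
  under eq_bigr do rewrite mulr_sumr.
  rewrite exchange_big/= mulr_natl.
  have -> : dl *+ (N * #|S|) = \sum_(p : 'I_N * 'I_#|S|) dl.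
    by rewrite sumr_const card_prod (card_ord N) (card_ord #|S|).
  apply: ler_sum => -[r i] _ /=; case: (boolP (i != i0)) => ii0; first exact: nuBB.
  by rewrite big1 ?(ltW dl0)// => l _; rewrite mulr0.
have -> : (N * #|S|)%:R * dl = e - dl.
  by rewrite /dl; field; rewrite gt_eqF// ltr_wpDr.
rewrite -/mvd; move: Vge nuB0; rewrite /e; lra.
Qed.

End Moved.

Lemma stably_weakly_equivalent_same_type (R : realType) (Gamma : countGroupType)
    (a b : pmp_action R Gamma) : stably_weakly_equivalent a b -> same_type a b.
Proof.
move=> [ab ba] S mS.
set G := [set S : set (BorelSub Gamma) | exists F : seq Gamma,
         S = [set H | forall g, g \in F -> val H g = false]].
apply: (measure_unique G (fun=> setT) (@cylinders_generate Gamma)) => //.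
- move=> _ _ [F ->] [F' ->]; exists (F ++ F'); apply/seteqP; split=> H /=.
    by move=> [h1 h2] g; rewrite mem_cat => /orP[/h1|/h2].
  by move=> h; split=> g gF; apply: h; rewrite mem_cat gF ?orbT.
- by move=> _; exists [::]; apply/seteqP; split.
- by apply/seteqP; split=> // x _; exists 0%N.
- move=> _ [F ->].
  have stabE (c : pmp_action R Gamma) :
      @stab R Gamma c @^-1` [set H | forall g, g \in F -> val H g = false] =
      @moved_points R Gamma c F.
    apply/seteqP; split=> x /= xF g gF; first by move/eqP; rewrite xF.
    by apply/negbTE/eqP; exact: xF.
  rewrite -[LHS]/(meas a (@stab R Gamma a @^-1` _)) -[RHS]/(meas b (@stab R Gamma b @^-1` _)).
  rewrite !stabE !prE; try exact: measurable_moved_points.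
  by congr EFin; apply/eqP; rewrite eq_le !stably_weakly_contained_moved.
- by move=> _; rewrite ltey_eq fin_num_measure.
Qed.

(** * From transferred colourings to weak containment *)

(** The totals agree, so an excess of [r i] over [p i] is paid for by deficits elsewhere, each at
    most [e]. *)
Lemma two_sided (R : realFieldType) (I : finType) (p r : I -> R) (e : R) :
  0 <= e -> \sum_i p i = \sum_i r i -> (forall i, p i - e <= r i) ->
  forall i, `|p i - r i| <= #|I|%:R * e.
Proof.
move=> e0 pr_eq per i.
have I1 : 1 <= #|I|%:R :> R by rewrite ler1n; apply/card_gt0P; exists i.
have h1 := per i; rewrite ler_norml; apply/andP; split; last by nra.
have : \sum_(j | j != i) p j - #|I|%:R * e <= \sum_(j | j != i) r j.
  rewrite lerBlDr mulr_natl -sumr_const [X in _ + X](bigID (fun j => j == i))/=.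
  rewrite addrCA ler_wpDl ?sumr_ge0// -big_split; apply: ler_sum => j _.
  by rewrite -lerBlDr.
by move: pr_eq; rewrite (bigD1 i)//= [RHS](bigD1 i)//=; lra.
Qed.

Section Contained.
Context (R : realType) (Gamma : countGroupType).
Variables (a b : pmp_action R Gamma).

Lemma borel_partition_colouring d (X : measurableType d) k (A : 'I_k -> set X) :
  borel_partition A -> exists2 colour : X -> 'I_k, fin_measurable colour &
    forall i, A i = [set x | colour x = i].
Proof.
move=> [mA tA AT].
have cA x : exists i, A i x.
  by have : [set: X] x by []; rewrite -AT => -[i _ Ai]; exists i.
pose colour x := sval (cid (cA x)).
have AE i : A i = [set x | colour x = i].
  apply/seteqP; split=> x /=; last by move=> <-; exact: (svalP (cid (cA x))).
  move=> Aix; apply: tA => //; exists x; split=> //.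
  exact: (svalP (cid (cA x))).
by exists colour => // i; rewrite -AE.
Qed.

Lemma image_preimage_pr (c : pmp_action R Gamma) (S : finType) (f : c -> S) g i j : fin_measurable f ->
  pr (meas c) (act c g @` [set x | f x = i] `&` [set x | f x = j]) =
  pr (meas c) [set x | f x = i /\ f (act c g x) = j].
Proof.
move=> mf; rewrite -[RHS](pr_act g^-1%g); last first.
  by apply: measurableI; [exact: mf|exact: fin_measurable_act].
congr (pr _ _); rewrite image_act; apply/seteqP; split=> x /=.
  by move=> [xi xj]; rewrite actVK.
by rewrite actVK.
Qed.

Lemma sum_joint_pr (c : pmp_action R Gamma) k (f : c -> 'I_k) g : fin_measurable f ->
  \sum_(p : 'I_k * 'I_k) pr (meas c) [set x | f x = p.1 /\ f (act c g x) = p.2] = 1.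
Proof.
move=> mf; rewrite -(sum_pr_fin (meas c) (fin_measurable_pair mf (fin_measurable_act g mf))).
apply: eq_bigr => -[i j] _; congr (pr _ _); apply/seteqP; split=> x /= => [[-> ->]//|[-> ->]//].
Qed.

Hypotheses (am : amenable R Gamma) (ab : same_patterns a b).

Lemma random_partition k (A : 'I_k -> set a) (F : set Gamma) (eps : R) :
  borel_partition A -> finite_set F -> 0 < eps ->
  exists (Om : finType) (wt : Om -> R) (col : Om -> b -> 'I_k),
  [/\ forall w, 0 <= wt w, \sum_w wt w = 1, forall w, fin_measurable (col w),
    forall g i j, F g -> `|pr (meas a) (act a g @` A i `&` A j) -
      \sum_w wt w * pr (meas b) (act b g @` [set y | col w y = i] `&` [set y | col w y = j])| < eps
  & (forall y : b, meas b [set y] = 0%E) -> exists w, forall g i j, F g ->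
     `|pr (meas a) (act a g @` A i `&` A j) -
      pr (meas b) (act b g @` [set y | col w y = i] `&` [set y | col w y = j])| < eps].
Proof.
move=> /borel_partition_colouring[colour mc AE] /finite_seqP[s ->] eps0.
have d0 : 'I_k := colour point.
(* [two_sided] multiplies the error by the number of pairs of colours; the added 1 makes the final
   bound strict. *)
pose e := eps / (#|{: 'I_k * 'I_k}|%:R + 1).
have K1 : 0 < #|{: 'I_k * 'I_k}|%:R + 1 :> R by rewrite ltr_wpDl.
have e0 : 0 < e by rewrite divr_gt0.
have Ke : #|{: 'I_k * 'I_k}|%:R * e < eps by rewrite /e mulrA ltr_pdivrMr// mulrC ltr_pM2l//; lra.
have [Om [wt [col [wt0 wt1 mcol mean_ge conc]]]] :=
  random_transfer (fun l : 'I_(size s) => tnth (in_tuple s) l) d0 am ab mc e0.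
pose joint w g i j := pr (meas b) [set y | col w y = i /\ col w (act b g y) = j].
exists Om, wt, col; split=> //.
  move=> g i j /= /(tnthP (in_tuple s))[l ->].
  under eq_bigr => w _ do rewrite (image_preimage_pr _ _ _ (mcol w)).
  rewrite !AE (image_preimage_pr _ _ _ mc); apply: le_lt_trans Ke.
  set h := tnth _ l.
  apply: (two_sided (p := fun p => pr (meas a) [set x | colour x = p.1 /\ colour (act a h x) = p.2])
    (r := fun p => \sum_w wt w * joint w h p.1 p.2) (ltW e0) _ _ (i, j)).
    rewrite sum_joint_pr// exchange_big/= -wt1; apply: eq_bigr => w _.
    by rewrite -mulr_sumr sum_joint_pr// mulr1.
  by move=> p; exact: mean_ge.
move=> /conc[w cw]; exists w => g i j /= /(tnthP (in_tuple s))[l ->].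
rewrite !AE (image_preimage_pr _ _ _ mc) (image_preimage_pr _ _ _ (mcol w)); apply: le_lt_trans Ke.
set h := tnth _ l.
apply: (two_sided (p := fun p => pr (meas a) [set x | colour x = p.1 /\ colour (act a h x) = p.2])
  (r := fun p => joint w h p.1 p.2) (ltW e0) _ _ (i, j)).
  by rewrite !sum_joint_pr.
by move=> p; exact: cw.
Qed.

Lemma measurable_correlation (c : pmp_action R Gamma) k (A : 'I_k -> set c) g i j :
  borel_partition A -> measurable (act c g @` A i `&` A j).
Proof.
move=> [mA _ _]; rewrite image_act.
by apply: measurableI => //; exact: measurable_preimage_act.
Qed.

Lemma fibre_partition d (X : measurableType d) k (f : X -> 'I_k) :
  fin_measurable f -> borel_partition (fun i => [set x | f x = i]).
Proof.
move=> mf; split=> //; first by move=> i j _ _ [x [/= -> ->]].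
by apply/seteqP; split=> // x _; exists (f x).
Qed.

Lemma same_patterns_weakly_contained : (forall y : b, meas b [set y] = 0%E) ->
  weakly_contained a b.
Proof.
move=> b0 k A F eps pA finF eps0.
have [Om [wt [col [_ _ mcol _ /(_ b0)[w cw]]]]] := random_partition pA finF eps0.
have pB := fibre_partition (mcol w); exists (fun i => [set y | col w y = i]) => //.
move=> g Fg i j; rewrite !prE -?EFinB ?abse_EFin ?lte_fin; first exact: cw.
  exact: (measurable_correlation _ _ _ pB).
exact: measurable_correlation.
Qed.

(** The finite sample space is the factor with identity action, each outcome carrying its own
    colouring of [b]: expected correlations become correlations in the product. *)
Lemma same_patterns_stably_weakly_contained : stably_weakly_contained a b.
Proof.
move=> k A F eps pA finF eps0.
have [Om [wt [col [wt0 wt1 mcol close _]]]] := random_partition pA finF eps0.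
have [m Om_m] : exists m, m.+1 = #|Om|.
  case: (posnP #|Om|) => [/card0_eq Om0|Om0]; last by exists #|Om|.-1; rewrite prednK.
  by move: wt1; rewrite big_pred0 => // /esym/eqP; rewrite oner_eq0.
pose w_ (l : 'I_m.+1) := enum_val (cast_ord Om_m l).
have w_bij : bijective w_.
  exists (fun w => cast_ord (esym Om_m) (enum_rank w)) => [l|w].
    by rewrite /w_ enum_valK cast_ordK.
  by rewrite /w_ cast_ordKV enum_rankK.
pose alpha l : {nonneg R} := NngNum (wt0 (w_ l)).
have sumE (G : Om -> R) : \sum_(l : 'I_m.+1) G (w_ l) = \sum_w G w.
  by rewrite (reindex w_)//; exact: onW_bij.
exists m, alpha; split; first by rewrite -wt1 -(sumE wt).
pose B i := [set ly : 'I_m.+1 * b | col (w_ ly.1) ly.2 = i].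
have mB i : measurable (B i) by apply: measurable_sections => l; exact: (mcol (w_ l) i).
exists B.
  split=> //; first by move=> i j _ _ [x [xi xj]]; rewrite -xi -xj.
  by apply/seteqP; split=> // x _; exists (col (w_ x.1) x.2).
move=> g Fg i j; pose act2 (ly : 'I_m.+1 * b) := (ly.1, act b g ly.2).
have secE l : [set y | (act2 @` B i `&` B j) (l, y)] =
    act b g @` [set y | col (w_ l) y = i] `&` [set y | col (w_ l) y = j].
  apply/seteqP; split=> y [yi yj]; split=> //.
    by move: yi => [[l' y'] /= By [<- <-]]; exists y'.
  by move: yi => [y' By <-]; exists (l, y').
rewrite -/act2 eta_productE; last first.
  apply: measurable_sections => l; rewrite secE.
  exact: (measurable_correlation _ _ _ (fibre_partition (mcol (w_ l)))).
rewrite prE; last exact: measurable_correlation.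
rewrite -EFinB abse_EFin lte_fin; under eq_bigr do rewrite secE.
rewrite (sumE (fun w => wt w * pr (meas b)
  (act b g @` [set y | col w y = i] `&` [set y | col w y = j]))).
exact: close.
Qed.

End Contained.

Theorem theorem1p8 (R : realType) (Gamma : countGroupType)
    (amenable_Gamma : amenable R Gamma) (a b : pmp_action R Gamma) :
  (same_type a b <-> stably_weakly_equivalent a b) /\
  (same_type a b -> action_type a (@infinite_index Gamma) = 1%E ->
   weakly_equivalent a b).

Proof.
have pat (c c' : pmp_action R Gamma) : same_type c c' -> same_patterns c c'.
  exact: same_type_patterns.
have sym (c c' : pmp_action R Gamma) : same_type c c' -> same_type c' c.
  by move=> cc' S mS; rewrite cc'.
split; first split=> [ab|].
- by split; apply: same_patterns_stably_weakly_contained => //; [exact: pat|exact/pat/sym].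
- exact: stably_weakly_equivalent_same_type.
move=> ab inf_a; have inf_b : action_type b (@infinite_index Gamma) = 1%E.
  by rewrite -ab//; exact: measurable_infinite_index.
split; apply: same_patterns_weakly_contained => //.
- exact: pat.
- by move=> y; exact: infinite_index_atomless.
- exact/pat/sym.
- by move=> y; exact: infinite_index_atomless.
Qed.
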